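(* Let $X$ be a complex Banach space and let $A:D(A)\subset X\to X$ be the generator of an analytic ($C_0$-)semigroup $(e^{tA})_{t\ge0}$ of bounded linear operators on $X$. Let $B:D(B)\subset X\to X$ be a linear operator, assume that $A+B$ generates a strongly continuous semigroup $(e^{t(A+B)})_{t\ge0}$ on $X$, and assume: (1) $B$ is $\theta$-subordinate to $A$ for some $0\le\theta<1$; (2) for every $t>0$, the operator $Be^{tA}$ is compact on $X$; (3) $(e^{tA})_{t\ge0}$ is uniformly exponentially stable, i.e. there exist $M_A\ge1$ and $\omega_A>0$ such that $\|e^{tA}\|_{\mathcal L(X)}\le M_Ae^{-\omega_A t}$ for all $t>0$; (4) $(e^{t(A+B)})_{t\ge0}$ is strongly stable, i.e. $\lim_{t\to+\infty}\|e^{t(A+B)}x\|=0$ for all $x\in X$. Then $(e^{t(A+B)})_{t\ge0}$ is uniformly exponentially stable, i.e. there exist $\widehat M\ge1$ and $\widehat\omega>0$ such that $\|e^{t(A+B)}\|_{\mathcal L(X)}\le\widehat M e^{-\widehat\omega t}$ for all $t>0$.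
   Context: A linear operator $B:D(B)\to X$ is $\theta$-subordinate to $A$ (with $0\le\theta<1$) if $D(A)\subseteq D(B)$ and there is a constant $c>0$ such that $\|Bx\|\le c\,\|Ax\|^{\theta}\|x\|^{1-\theta}$ for all $x\in D(A)$ (for $\theta=0$ this reads $\|Bx\|\le c\|x\|$). The operator $A+B$ has domain $D(A+B)=D(A)$. *)

(* Defs.v *)
From Stdlib Require Import Reals.
From Coquelicot Require Import Coquelicot.

Set Implicit Arguments.
Unset Strict Implicit.
Unset Printing Implicit Defensive.

Open Scope R_scope.

(* A partially defined operator; the values of [app] outside [dom] are
   irrelevant. *)
Record operator (X : Type) := Operator {
  dom : X -> Prop;
  app : X -> X
}.

Definition linear_operator (X : ModuleSpace C_AbsRing) (B : operator X) : Prop :=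
  dom B zero /\
  (forall x y, dom B x -> dom B y ->
     dom B (plus x y) /\ app B (plus x y) = plus (app B x) (app B y)) /\
  (forall (k : C) x, dom B x ->
     dom B (scal k x) /\ app B (scal k x) = scal k (app B x)).

(* The domain is D(A); this is meant for D(A) included in D(B). *)
Definition add_operator (X : ModuleSpace C_AbsRing) (A B : operator X) :
    operator X :=
  Operator (dom A) (fun x => plus (app A x) (app B x)).

(* Takes values in [Rbar]: it is [p_infty] on unbounded maps. *)
Definition opnorm (X : NormedModule C_AbsRing) (L : X -> X) : Rbar :=
  Lub_Rbar (fun r => exists x, norm x <= 1 /\ r = norm (L x)).

(* Real powers of x >= 0, with 0^0 = 1; [Rpower 0 p] is 1 also when p > 0. *)
Definition nnpow (x p : R) : R :=
  if Req_EM_T p 0 then 1 else if Req_EM_T x 0 then 0 else Rpower x p.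

Definition subordinate (X : NormedModule C_AbsRing) (theta : R)
    (B A : operator X) : Prop :=
  (forall x, dom A x -> dom B x) /\
  exists c, 0 < c /\ forall x, dom A x ->
    norm (app B x) <= c * nnpow (norm (app A x)) theta * nnpow (norm x) (1 - theta).

Definition compact_operator (X : NormedModule C_AbsRing) (L : X -> X) : Prop :=
  is_linear L /\
  forall (u : nat -> X) (b : R), (forall n, norm (u n) <= b) ->
  exists (k : nat -> nat) (y : X),
    (forall n, (k n < k (S n))%nat) /\
    filterlim (fun n => L (u (k n))) eventually (locally y).

(* [is_linear] includes boundedness. Only the values of T on [0, +oo) matter. *)
Definition C0_semigroup (X : NormedModule C_AbsRing) (T : R -> X -> X) : Prop :=
  (forall t, 0 <= t -> is_linear (T t)) /\
  (forall x, T 0 x = x) /\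
  (forall s t x, 0 <= s -> 0 <= t -> T (s + t) x = T s (T t x)) /\
  (forall x, filterlim (fun t => T t x) (at_right 0) (locally x)).

(* The equivalence says that the graph of A is the set of all (x, y) with
   (T(h)x - x)/h -> y, so it determines both D(A) and the values of A. *)
Definition generates (X : NormedModule C_AbsRing) (A : operator X)
    (T : R -> X -> X) : Prop :=
  C0_semigroup T /\
  forall x y : X,
    (dom A x /\ app A x = y) <->
    filterlim (fun h : R => scal (RtoC (/ h)) (minus (T h x) x))
      (at_right 0) (locally y).

Definition sector (delta : R) (z : C) : Prop :=
  exists r phi, 0 < r /\ Rabs phi < delta /\ z = (r * cos phi, r * sin phi).

(* Complex differentiability at z with respect to the operator norm. *)
Definition norm_differentiable (X : NormedModule C_AbsRing)
    (T : C -> X -> X) (z : C) : Prop :=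
  exists L : X -> X, is_linear L /\
  forall eps : R, 0 < eps ->
    locally' (0 : C) (fun h : C =>
      Rbar_lt (opnorm (fun x =>
        minus (scal (Cinv h) (minus (T (Cplus z h) x) (T z x))) (L x))) eps).

(* A strongly continuous semigroup is analytic when it extends to an open
   sector of half-angle delta around the positive reals as a holomorphic
   semigroup, strongly continuous at 0 on every smaller sector. *)
Definition analytic_semigroup (X : NormedModule C_AbsRing)
    (T : R -> X -> X) : Prop :=
  C0_semigroup T /\
  exists (delta : R) (U : C -> X -> X),
    0 < delta <= PI / 2 /\
    (forall t x, 0 <= t -> U (RtoC t) x = T t x) /\
    (forall z, sector delta z -> is_linear (U z)) /\
    (forall z w x, sector delta z -> sector delta w ->
       U (Cplus z w) x = U z (U w x)) /\
    (forall z, sector delta z -> norm_differentiable U z) /\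
    (forall delta' x, 0 < delta' < delta ->
       filterlim (fun z => U z x) (within (sector delta') (locally (0 : C)))
         (locally x)).

Definition uniformly_exp_stable (X : NormedModule C_AbsRing)
    (T : R -> X -> X) : Prop :=
  exists M omega : R, 1 <= M /\ 0 < omega /\
    forall t, 0 < t -> Rbar_le (opnorm (T t)) (M * exp (- omega * t)).

Definition strongly_stable (X : NormedModule C_AbsRing)
    (T : R -> X -> X) : Prop :=
  forall x, is_lim (fun t => norm (T t x)) p_infty 0.

(* Main.v *)
Require Import Defs.
From Stdlib Require Import Reals.
From Coquelicot Require Import Coquelicot.
From Stdlib Require Import Lra Lia Classical ClassicalEpsilon.

Open Scope R_scope.

(** Write [T t] for the semigroup generated by [A] and [S t] for the one generated
    by [A + B]. The orbit [f s = S (t - s) (T s x)] runs from [S t x] at [s = 0] to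
    [S (t - N) (T N x)] at [s = N], and formally [f' s = - S (t - s) B T(s) x]. So
    [S t] is estimated by three contributions.

    - Near [s = 0], analyticity gives [|A T(s)| <= K / s], hence by subordination
      [|B T(s)| <= c s^(- theta)], which is integrable because [theta < 1]: the
      increment of [f] over [0, e] is small with [e], uniformly in [t]
      ([orbit_increment_near_0]).
    - For [e <= s <= N] one has [B T(s) = B T(e) T(s - e)] with [B T(e)] compact.
      The operators [S r] are bounded for large [r] and tend to zero strongly, so
      [S r B T(e)] tends to zero in operator norm ([strong_stability_compact]) and
      the increment is small once [t - N] is large
      ([orbit_increment_away_from_0]).
    - At [s = N], [|S (t - N) T(N)| <= M M_T exp (- w N)] is small for large [N].

    Choosing [e], then [N], then [t] gives [|S t| <= 1 / 2] for some [t], and the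
    semigroup law turns this into exponential decay ([contraction_exp_stable]).

    No vector-valued integral is used. Increments of [f] are bounded by a mean value
    inequality for right increments ([mean_value_ineq]), for which it is enough that
    [f (s + h) - f s = S (t - s - h) (T(h) - S(h)) T(s) x], where [T(s) x] lies in
    the common domain of the two generators.

    The estimate [|A T(t)| <= K / t] for small [t] is Cauchy's inequality for the derivative of
    the holomorphic extension [U] of [T]. Uniform boundedness gives a bound [M] for
    [U] near the vertex of a sector. The function
    [w (a, b) = U (t + a + i b) x - U (t - a + i b) x] is harmonic and vanishes for
    [a = 0], so [|w|] is subharmonic and is dominated on a rectangle of size
    proportional to [t] by an explicit harmonic quadratic polynomial
    ([submean_value_bound]); on the real axis this says [|w (a, 0)| <= C a / t],
    and dividing by [2 a] bounds the derivative ([cauchy_estimate]). *)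

(** * Linear identities in a complex vector space *)

(** Formal linear combinations, for deciding by reflection identities between
    combinations of the same vectors: it is enough to compare coefficients. *)
Inductive vexpr :=
  | Vatom (n : nat) | Vzero | Vplus (e f : vexpr) | Vopp (e : vexpr)
  | Vscal (c : C) (e : vexpr).

Fixpoint veval {X : ModuleSpace C_AbsRing} (l : list X) (e : vexpr) : X :=
  match e with
  | Vatom n => List.nth n l zero
  | Vzero => zero
  | Vplus e f => plus (veval l e) (veval l f)
  | Vopp e => opp (veval l e)
  | Vscal c e => scal c (veval l e)
  end.

Fixpoint vcoef (e : vexpr) (n : nat) : C :=
  match e with
  | Vatom m => if Nat.eqb m n then RtoC 1 else RtoC 0
  | Vzero => RtoC 0
  | Vplus e f => Cplus (vcoef e n) (vcoef f n)
  | Vopp e => Copp (vcoef e n)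
  | Vscal c e => Cmult c (vcoef e n)
  end.

Fixpoint vcomb {X : ModuleSpace C_AbsRing} (f : nat -> C) (l : list X) : X :=
  match l with
  | nil => zero
  | cons x l => plus (scal (f O) x) (vcomb (fun n => f (S n)) l)
  end.

Fixpoint coefs_agree (f g : nat -> C) (n : nat) : Prop :=
  match n with
  | O => True
  | S n => f O = g O /\ coefs_agree (fun k => f (S k)) (fun k => g (S k)) n
  end.

Lemma vcomb_agree (X : ModuleSpace C_AbsRing) (l : list X) f g :
  coefs_agree f g (length l) -> vcomb f l = vcomb g l.
Proof.
  revert f g; induction l as [|x l IH]; intros f g; [reflexivity|].
  intros [H1 H2]; simpl; rewrite H1, (IH _ _ H2); reflexivity.
Qed.

Lemma vcomb_plus (X : ModuleSpace C_AbsRing) (l : list X) f g :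
  vcomb (fun n => Cplus (f n) (g n)) l = plus (vcomb f l) (vcomb g l).
Proof.
  revert f g; induction l as [|x l IH]; intros f g; simpl.
  - rewrite plus_zero_l; reflexivity.
  - rewrite (IH (fun n => f (S n)) (fun n => g (S n))).
    rewrite (scal_distr_r (f O : C_AbsRing) (g O) x : scal (Cplus _ _) _ = _).
    rewrite !plus_assoc. f_equal.
    rewrite <- !plus_assoc. f_equal. apply plus_comm.
Qed.

Lemma vcomb_scal (X : ModuleSpace C_AbsRing) (l : list X) c f :
  vcomb (fun n => Cmult c (f n)) l = scal c (vcomb f l).
Proof.
  revert f; induction l as [|x l IH]; intros f; simpl.
  - rewrite scal_zero_r; reflexivity.
  - rewrite (IH (fun n => f (S n))), scal_distr_l, scal_assoc; reflexivity.
Qed.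

Lemma vcomb_zero (X : ModuleSpace C_AbsRing) (l : list X) :
  vcomb (fun _ => RtoC 0) l = zero.
Proof.
  induction l as [|x l IH]; simpl; [reflexivity|].
  rewrite IH, plus_zero_r. apply (scal_zero_l x).
Qed.

Lemma vcomb_atom (X : ModuleSpace C_AbsRing) (l : list X) m :
  vcomb (vcoef (Vatom m)) l = List.nth m l zero.
Proof.
  revert m; induction l as [|x l IH]; intros [|m]; try reflexivity.
  - simpl. rewrite vcomb_zero, plus_zero_r. apply (scal_one x).
  - transitivity (plus (scal (RtoC 0) x) (vcomb (vcoef (Vatom m)) l)); [reflexivity|].
    rewrite IH, (scal_zero_l x : scal (RtoC 0) x = zero), plus_zero_l.
    reflexivity.
Qed.

Lemma veval_vcomb (X : ModuleSpace C_AbsRing) (l : list X) e :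
  veval l e = vcomb (vcoef e) l.
Proof.
  induction e as [n| |e IHe f IHf|e IHe|c e IHe].
  - symmetry; apply vcomb_atom.
  - symmetry; apply vcomb_zero.
  - simpl veval; rewrite IHe, IHf; symmetry; apply vcomb_plus.
  - simpl veval; rewrite IHe, <- scal_opp_one.
    change (opp one) with (Copp (RtoC 1)). rewrite <- vcomb_scal.
    apply vcomb_agree. simpl vcoef.
    generalize (vcoef e); generalize (length l) as n.
    induction n as [|n IHn]; intros f; simpl; [exact I|].
    split; [ring|]. apply (IHn (fun k => f (S k))).
  - simpl veval; rewrite IHe; symmetry; apply vcomb_scal.
Qed.

Lemma veval_eq (X : ModuleSpace C_AbsRing) (l : list X) e f :
  coefs_agree (vcoef e) (vcoef f) (length l) -> veval l e = veval l f.
Proof. intros H; rewrite !veval_vcomb; apply vcomb_agree, H. Qed.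

Ltac vatoms l t :=
  lazymatch t with
  | zero => l
  | plus ?a ?b => let l := vatoms l a in vatoms l b
  | minus ?a ?b => let l := vatoms l a in vatoms l b
  | opp ?a => vatoms l a
  | scal ?c ?a => vatoms l a
  | _ => let rec mem m := lazymatch m with
           | nil => constr:(cons t l) | cons t _ => l | cons _ ?m => mem m end
         in mem l
  end.

Ltac vindex l t :=
  lazymatch l with
  | cons t _ => constr:(O)
  | cons _ ?l => let n := vindex l t in constr:(S n)
  end.

Ltac vreify l t :=
  lazymatch t with
  | zero => constr:(Vzero)
  | plus ?a ?b =>
      let e := vreify l a in let f := vreify l b in constr:(Vplus e f)
  | minus ?a ?b =>
      let e := vreify l a in let f := vreify l b in constr:(Vplus e (Vopp f))
  | opp ?a => let e := vreify l a in constr:(Vopp e)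
  | scal ?c ?a => let e := vreify l a in constr:(Vscal c e)
  | _ => let n := vindex l t in constr:(Vatom n)
  end.

(** Leaves the equations between coefficients as goals, since they may need [field]. *)
Ltac vlin :=
  lazymatch goal with
  | |- ?a = ?b =>
      let T := type of a in
      let l := vatoms (@nil T) a in let l := vatoms l b in
      let e := vreify l a in let f := vreify l b in
      refine (veval_eq _ l e f _);
      cbv [coefs_agree vcoef length Nat.eqb]; repeat split
  end.

Ltac vring := vlin; ring.

(** * Norms *)

Lemma norm_minus_sym (X : NormedModule C_AbsRing) (x y : X) :
  norm (minus x y) = norm (minus y x).
Proof. rewrite <- norm_opp. f_equal. vring. Qed.

Lemma norm_minus_diag (X : NormedModule C_AbsRing) (x : X) :
  norm (minus x x) = 0.
Proof. rewrite (minus_eq_zero x). apply norm_zero. Qed.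

Lemma norm_minus_triangle (X : NormedModule C_AbsRing) (y x z : X) :
  norm (minus x z) <= norm (minus x y) + norm (minus y z).
Proof.
  replace (minus x z) with (plus (minus x y) (minus y z)) by vring.
  apply norm_triangle.
Qed.

Lemma norm_minus_le (X : NormedModule C_AbsRing) (x y : X) :
  norm (minus x y) <= norm x + norm y.
Proof. unfold minus. rewrite <- (norm_opp y). apply norm_triangle. Qed.

Lemma norm_le_minus (X : NormedModule C_AbsRing) (x y : X) :
  norm x <= norm y + norm (minus x y).
Proof.
  replace x with (plus y (minus x y)) at 1 by vring. apply norm_triangle.
Qed.

Lemma norm_scalC (X : NormedModule C_AbsRing) (k : C) (x : X) :
  norm (scal k x) = Cmod k * norm x.
Proof.
  apply Rle_antisym; [apply (norm_scal (k : C_AbsRing))|].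
  destruct (Req_dec (Cmod k) 0) as [H|H].
  - rewrite H, Rmult_0_l. apply norm_ge_0.
  - assert (Hk : k <> RtoC 0) by (intros ->; apply H, Cmod_0).
    assert (H0 : 0 < Cmod k) by (apply Cmod_gt_0, Hk).
    apply (Rmult_le_reg_l (/ Cmod k)); [apply Rinv_0_lt_compat, H0|].
    rewrite <- Rmult_assoc, Rinv_l, Rmult_1_l by lra.
    rewrite <- Cmod_inv by exact Hk.
    replace x with (scal (Cinv k) (scal k x)) at 1.
    + apply (norm_scal (Cinv k : C_AbsRing)).
    + vlin. field. exact Hk.
Qed.

Lemma norm_scalR (X : NormedModule C_AbsRing) (a : R) (x : X) :
  0 <= a -> norm (scal (RtoC a) x) = a * norm x.
Proof. intros Ha. rewrite norm_scalC, Cmod_R, Rabs_pos_eq; [reflexivity|exact Ha]. Qed.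

(** * A mean value inequality *)

Definition norm_continuous_on {K : AbsRing} {V : NormedModule K}
    (f : R -> V) (a b : R) : Prop :=
  forall s eps, a <= s <= b -> 0 < eps -> exists d, 0 < d /\
    forall s', a <= s' <= b -> Rabs (s' - s) < d ->
      norm (minus (f s') (f s)) <= eps.

(** The supremum of the points up to which [p] stays below the line of slope
    [eps] through [(a, p a)] can only be [b], because the condition on the right
    at any earlier point would push it further. *)
Lemma dini_nonincreasing (p : R -> R) (a b : R) :
  a <= b -> norm_continuous_on p a b ->
  (forall s eps, a <= s < b -> 0 < eps -> exists d, 0 < d /\
     forall h, 0 < h < d -> s + h <= b -> p (s + h) <= p s + eps * h) ->
  p b <= p a.
Proof.
  intros Hab Hc Hd.
  assert (Heps : forall eps, 0 < eps -> p b <= p a + eps * (b - a)).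
  { intros eps He.
    set (E := fun s => a <= s <= b /\
                forall s', a <= s' <= s -> p s' <= p a + eps * (s' - a)).
    assert (Ea : E a).
    { split; [lra|]. intros s' Hs. replace s' with a by lra. lra. }
    destruct (completeness E) as [c [Hub Hlub]].
    { exists b. intros s [Hs _]. lra. }
    { exists a. exact Ea. }
    assert (Hac : a <= c) by (apply Hub, Ea).
    assert (Hcb : c <= b) by (apply Hlub; intros s [Hs _]; lra).
    assert (Hlt : forall s', a <= s' < c -> p s' <= p a + eps * (s' - a)).
    { intros s' Hs'. destruct (classic (exists e, E e /\ s' < e)) as [[e [[_ He1] He2]]|Hn].
      - apply He1; lra.
      - exfalso. assert (c <= s'); [|lra]. apply Hlub. intros e Ee.
        destruct (Rle_or_lt e s'); [assumption|]. exfalso; apply Hn; exists e; tauto. }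
    assert (Hpc : p c <= p a + eps * (c - a)).
    { destruct (Req_dec c a) as [->|Hne]; [lra|].
      apply le_epsilon. intros z Hz.
      destruct (Hc c z) as [d [Hd0 Hd1]]; [lra|lra|].
      set (s' := Rmax a (c - d / 2)).
      assert (Hs' : a <= s' < c /\ c - s' < d)
        by (unfold s', Rmax; destruct (Rle_dec a (c - d/2)); lra).
      specialize (Hd1 s'). specialize (Hlt s').
      change (norm (minus (p s') (p c))) with (Rabs (p s' - p c)) in Hd1.
      assert (Hx : Rabs (p s' - p c) <= z) by (apply Hd1; [lra|]; apply Rabs_def1; lra).
      apply Rabs_le_between in Hx.
      assert (p s' <= p a + eps * (s' - a)) by (apply Hlt; lra).
      assert (eps * (s' - a) <= eps * (c - a)) by (apply Rmult_le_compat_l; lra). lra. }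
    destruct (Req_dec c b) as [<-|Hne]; [exact Hpc|].
    exfalso. destruct (Hd c eps) as [d [Hd0 Hd1]]; [lra|lra|].
    set (h := Rmin (d / 2) (b - c)).
    assert (Hh : 0 < h < d /\ c + h <= b)
      by (unfold h, Rmin; destruct (Rle_dec (d/2) (b-c)); lra).
    assert (c + h <= c); [|lra]. apply Hub. split; [lra|].
    intros s' Hs'. destruct (Rle_or_lt s' c) as [H|H].
    - destruct (Req_dec s' c) as [->|]; [exact Hpc|apply Hlt; lra].
    - specialize (Hd1 (s' - c)). replace (c + (s' - c)) with s' in Hd1 by ring.
      assert (p s' <= p c + eps * (s' - c)) by (apply Hd1; lra).
      lra. }
  apply le_epsilon. intros z Hz.
  assert (H := Heps (z / (b - a + 1))).
  assert (0 < z / (b - a + 1)) by (apply Rdiv_lt_0_compat; lra).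
  assert (z / (b - a + 1) * (b - a) <= z).
  { apply Rle_trans with (z / (b - a + 1) * (b - a + 1)).
    - apply Rmult_le_compat_l; lra.
    - right; field; lra. }
  lra.
Qed.

(** Bounding right increments only is essential: the orbits below are known to be
    differentiable from the right, through the definition of a generator. *)
Lemma mean_value_ineq (X : NormedModule C_AbsRing) (f : R -> X) (G : R -> R)
    (a b : R) :
  a <= b -> norm_continuous_on f a b -> norm_continuous_on G a b ->
  (forall s eps, a <= s < b -> 0 < eps -> exists d, 0 < d /\
     forall h, 0 < h < d -> s + h <= b ->
       norm (minus (f (s + h)) (f s)) <= G (s + h) - G s + eps * h) ->
  norm (minus (f b) (f a)) <= G b - G a.
Proof.
  intros Hab Hf HG Hd.
  set (p := fun s => norm (minus (f s) (f a)) - G s).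
  assert (Hp : p b <= p a).
  { apply dini_nonincreasing; [exact Hab| |].
    - intros s eps Hs He.
      destruct (Hf s (eps / 2)) as [d1 [Hd1 H1]]; [lra|lra|].
      destruct (HG s (eps / 2)) as [d2 [Hd2 H2]]; [lra|lra|].
      exists (Rmin d1 d2). split; [apply Rmin_glb_lt; assumption|].
      intros s' Hs' Hlt. unfold p.
      specialize (H1 s' Hs' (Rlt_le_trans _ _ _ Hlt (Rmin_l _ _))).
      specialize (H2 s' Hs' (Rlt_le_trans _ _ _ Hlt (Rmin_r _ _))).
      change (Rabs (G s' - G s) <= eps / 2) in H2.
      change (Rabs (norm (minus (f s') (f a)) - G s' -
                     (norm (minus (f s) (f a)) - G s)) <= eps).
      assert (T1 := norm_minus_triangle X (f s) (f s') (f a)).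
      assert (T2 := norm_minus_triangle X (f s') (f s) (f a)).
      rewrite norm_minus_sym in T2.
      rewrite (norm_minus_sym X (f s) (f s')) in T2.
      rewrite (norm_minus_sym X (f a) (f s)) in T2.
      apply Rabs_le_between in H2. apply Rabs_le_between. lra.
    - intros s eps Hs He. destruct (Hd s eps Hs He) as [d [Hd0 H]].
      exists d. split; [exact Hd0|]. intros h Hh Hb. specialize (H h Hh Hb).
      unfold p. assert (T1 := norm_minus_triangle X (f s) (f (s + h)) (f a)). lra. }
  unfold p in Hp. rewrite norm_minus_diag in Hp. lra.
Qed.

(** * Uniform boundedness *)

Lemma filterlim_norm_iff (T : Type) (X : NormedModule C_AbsRing)
    (F : (T -> Prop) -> Prop) {FF : Filter F} (f : T -> X) (y : X) :
  filterlim f F (locally y) <->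
  forall eps, 0 < eps -> F (fun t => norm (minus (f t) y) < eps).
Proof.
  rewrite filterlim_locally. split; intros H eps.
  - intros He. assert (Hf := @norm_factor_gt_0 _ X).
    assert (He' : 0 < eps / @norm_factor _ X) by (apply Rdiv_lt_0_compat; assumption).
    eapply filter_imp; [|exact (H (mkposreal _ He'))]. intros t Ht.
    apply norm_compat2 in Ht. simpl in Ht.
    replace (norm_factor * (eps / norm_factor)) with eps in Ht by (field; lra).
    exact Ht.
  - eapply filter_imp; [|exact (H eps (cond_pos eps))]. intros t Ht. apply norm_compat1, Ht.
Qed.

(** Completeness is kept as a hypothesis on a [NormedModule], so that the vector
    operations in later statements are all taken from the same structure. *)
Definition sequentially_complete (X : NormedModule C_AbsRing) : Prop :=
  forall u : nat -> X,
  (forall eps, 0 < eps -> exists N, forall n m, (N <= n)%nat -> (N <= m)%nat ->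
     norm (minus (u n) (u m)) < eps) ->
  exists x, forall eps, 0 < eps -> exists N, forall n, (N <= n)%nat ->
     norm (minus (u n) x) < eps.

Lemma complete_sequentially_complete (X : CompleteNormedModule C_AbsRing) :
  sequentially_complete X.
Proof.
  intros u H.
  destruct (proj1 (filterlim_locally_cauchy (U := X) (F := eventually) u))
    as [x Hx].
  - intros eps. destruct (H eps (cond_pos eps)) as [N HN].
    exists (fun n => (N <= n)%nat). split; [exists N; auto|].
    intros n m Hn Hm. apply (norm_compat1 (V := X)). apply HN; assumption.
  - exists x. intros eps He.
    exact (proj1 (filterlim_norm_iff nat X eventually u x) Hx eps He).
Qed.

(** Writing [2 L u] as the difference of [L (y + u)] and [L (y - u)], one of
    these two vectors is at least as long as [L u]. *)
Lemma linear_large_near (X : NormedModule C_AbsRing) (L : X -> X) (x y : X)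
    (r N : R) :
  is_linear L -> 0 < r -> N * norm x < norm (L x) * r ->
  exists y', norm (minus y' y) <= r /\ N < norm (L y').
Proof.
  intros HL Hr Hx.
  assert (Hx0 : 0 < norm x).
  { destruct (norm_ge_0 x) as [|E]; [assumption|exfalso].
    symmetry in E; apply norm_eq_zero in E. subst x.
    rewrite (linear_zero L HL), norm_zero in Hx. lra. }
  set (u := scal (RtoC (r / norm x)) x).
  assert (Hk : 0 <= r / norm x) by (left; apply Rdiv_lt_0_compat; assumption).
  assert (Hu : norm u = r) by (unfold u; rewrite norm_scalR by exact Hk; field; lra).
  assert (HLu : N < norm (L u)).
  { unfold u. rewrite (linear_scal L HL), norm_scalR by exact Hk.
    apply Rmult_lt_reg_r with (norm x); [exact Hx0|].
    replace (r / norm x * norm (L x) * norm x) with (norm (L x) * r) by (field; lra).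
    exact Hx. }
  destruct (Rlt_or_le N (norm (L (plus y u)))) as [H|H].
  { exists (plus y u). split; [|exact H]. right. rewrite <- Hu. f_equal. vring. }
  exists (minus y u). split.
  - right. rewrite <- Hu, <- (norm_opp u). f_equal. vring.
  - assert (E : 2 * norm (L u) = norm (minus (L (plus y u)) (L (minus y u)))).
    { rewrite <- norm_scalR by lra. f_equal.
      rewrite (linear_plus L HL), (linear_minus L _ _ HL). vring. }
    assert (T := norm_minus_le X (L (plus y u)) (L (minus y u))). lra.
Qed.

(** Uniform boundedness for a family that is bounded at each vector only for
    indices with small [d], the smallness depending on the vector. With [d]
    measuring the distance to a limit time it turns strong convergence along that
    limit into a bound on operator norms near it. If the conclusion failed,
    nested balls could be chosen whose common point makes the family unbounded. *)
Lemma local_uniform_boundedness (X : NormedModule C_AbsRing) (I : Type)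
    (d : I -> R) (L : I -> X -> X) :
  sequentially_complete X ->
  (forall i, is_linear (L i)) ->
  (forall x, exists c eta, 0 < eta /\ forall i, d i < eta -> norm (L i x) <= c) ->
  exists M eta, 0 < M /\ 0 < eta /\
    forall i x, d i < eta -> norm (L i x) <= M * norm x.
Proof.
  intros HX HL Hpt. apply NNPP. intros Hneg.
  assert (Hbig : forall M eta, 0 < M -> 0 < eta ->
            exists i x, d i < eta /\ M * norm x < norm (L i x)).
  { intros M eta HM He. apply NNPP. intros H. apply Hneg. exists M, eta.
    repeat split; try assumption. intros i x Hi.
    apply Rnot_lt_le. intros Hlt. apply H. exists i, x. tauto. }
  assert (Hstep : forall s : nat * (X * R), exists s' : X * R,
    let n := fst s in let y := fst (snd s) in let r := snd (snd s) in
    let y' := fst s' in let r' := snd s' in 0 < r ->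
    0 < r' <= r / 2 /\ norm (minus y' y) <= r /\
    exists i, d i < / (INR n + 1) /\
      forall x, norm (minus x y') <= 2 * r' -> INR n <= norm (L i x)).
  { intros [n [y r]]; simpl.
    destruct (Rle_or_lt r 0) as [Hr|Hr]; [exists (y, r); lra|].
    assert (Hn := pos_INR n).
    destruct (Hbig ((INR n + 1) / r) (/ (INR n + 1))) as [i [x [Hi Hx]]].
    { apply Rdiv_lt_0_compat; lra. }
    { apply Rinv_0_lt_compat; lra. }
    destruct (linear_large_near X (L i) x y r (INR n + 1) (HL i) Hr) as [y' [Hy1 Hy2]].
    { apply Rmult_lt_reg_r with (/ r); [apply Rinv_0_lt_compat; lra|].
      replace (norm (L i x) * r * / r) with (norm (L i x)) by (field; lra).
      replace ((INR n + 1) * norm x * / r) with ((INR n + 1) / r * norm x)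
        by (field; lra). exact Hx. }
    destruct (linear_norm (L i) (HL i)) as [K [HK1 HK2]].
    exists (y', Rmin (r / 2) (/ (2 * K))); simpl. intros _.
    assert (HK3 : 0 < / (2 * K)) by (apply Rinv_0_lt_compat; lra).
    split; [split; [apply Rmin_glb_lt; lra|apply Rmin_l]|].
    split; [exact Hy1|]. exists i. split; [exact Hi|]. intros z Hz.
    assert (Hz2 : norm (L i (minus z y')) <= 1).
    { eapply Rle_trans; [apply HK2|].
      apply Rle_trans with (K * (2 * (/ (2 * K)))).
      - apply Rmult_le_compat_l; [lra|]. eapply Rle_trans; [exact Hz|].
        apply Rmult_le_compat_l; [lra|apply Rmin_r].
      - right; field; lra. }
    rewrite (linear_minus (L i) _ _ (HL i)) in Hz2.
    assert (T := norm_le_minus X (L i y') (L i z)).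
    rewrite norm_minus_sym in T. lra. }
  set (step := fun s => proj1_sig (constructive_indefinite_description _ (Hstep s))).
  set (sq := fix sq (n : nat) : X * R := match n with
                         | O => (zero : X, 1) | S n => step (n, sq n) end).
  set (y := fun n : nat => fst (sq n) : X). set (r := fun n => snd (sq n)).
  assert (Hs := fun n =>
    proj2_sig (constructive_indefinite_description _ (Hstep (n, sq n)))).
  cbv zeta in Hs. change (fun n => step (n, sq n)) with (fun n => sq (S n)) in Hs.
  assert (Hr : forall n, 0 < r n).
  { induction n as [|n IH]; [unfold r; simpl; lra|]. apply (Hs n), IH. }
  assert (Hrec : forall n, r (S n) <= r n / 2 /\ norm (minus (y (S n)) (y n)) <= r n /\
     exists i, d i < / (INR n + 1) /\
      forall x, norm (minus x (y (S n))) <= 2 * r (S n) -> INR n <= norm (L i x)).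
  { intros n. destruct (Hs n (Hr n)) as [[_ H1] [H2 H3]]. auto. }
  assert (Hrp : forall n, r n <= (/ 2) ^ n).
  { induction n as [|n IH]; [unfold r; simpl; lra|].
    destruct (Hrec n) as [H _]. simpl. lra. }
  assert (Hy : forall n k, norm (minus (y (n + k)%nat) (y n)) <= 2 * r n - 2 * r (n + k)%nat).
  { intros n k. induction k as [|k IH].
    - rewrite Nat.add_0_r, norm_minus_diag. right. ring.
    - rewrite Nat.add_succ_r. destruct (Hrec (n + k)%nat) as [H1 [H2 _]].
      assert (T := norm_minus_triangle X (y (n + k)%nat) (y (S (n + k))) (y n)). lra. }
  assert (Hy' : forall n m, (n <= m)%nat -> norm (minus (y m) (y n)) <= 2 * r n).
  { intros n m Hnm. replace m with (n + (m - n))%nat by lia.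
    assert (H := Hy n (m - n)%nat). assert (H' := Hr (n + (m - n))%nat). lra. }
  assert (Hpow : forall eps, 0 < eps -> exists N, 4 * r N < eps).
  { intros eps He. destruct (pow_lt_1_zero (/ 2)) with (y := eps / 4) as [N HN].
    { rewrite Rabs_pos_eq; lra. } { lra. }
    exists N. specialize (HN N (Nat.le_refl N)). specialize (Hrp N).
    apply Rabs_def2 in HN. lra. }
  destruct (HX y) as [z Hz].
  { intros eps He. destruct (Hpow eps He) as [N HN]. exists N.
    intros n m Hn Hm. assert (H1 := Hy' N n Hn). assert (H2 := Hy' N m Hm).
    assert (T := norm_minus_triangle X (y N) (y n) (y m)).
    rewrite (norm_minus_sym X (y N)) in T. lra. }
  assert (Hzy : forall n, norm (minus z (y n)) <= 2 * r n).
  { intros n. apply le_epsilon. intros eps He.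
    destruct (Hz eps He) as [N HN]. specialize (HN (Nat.max N n)).
    assert (H1 := Hy' n (Nat.max N n) (Nat.le_max_r _ _)).
    specialize (HN (Nat.le_max_l _ _)).
    assert (T := norm_minus_triangle X (y (Nat.max N n)) z (y n)).
    rewrite (norm_minus_sym X z (y (Nat.max N n))) in T. lra. }
  destruct (Hpt z) as [c [eta [He Hc]]].
  destruct (INR_archimed 1 (Rabs c + / eta + 1)) as [n Hn]; [lra|].
  destruct (Hrec n) as [_ [_ [i [Hi1 Hi2]]]].
  specialize (Hi2 z (Hzy _)).
  assert (H1 := Rle_abs c). assert (H2 := Rabs_pos c).
  assert (H3 : 0 < / eta) by (apply Rinv_0_lt_compat, He).
  assert (d i < eta).
  { eapply Rlt_trans; [exact Hi1|].
    rewrite <- (Rinv_inv eta). apply Rinv_lt_contravar; [apply Rmult_lt_0_compat; lra|lra]. }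
  specialize (Hc i H). lra.
Qed.

(** * A comparison principle for functions with the sub-mean-value property *)

(** The harmonic barrier [q (b^2 - a^2 + 2 a r)] with [q = m / r^2] dominates [v]
    on the boundary of the rectangle. Adding the strictly subharmonic term
    [(L + 1) rho (a^2 + b^2)] to [v] minus the barrier outweighs the error in the
    mean value inequality with step [rho], so the supremum is nearly attained
    within distance [rho] of the boundary only; then [rho] tends to zero. *)
Lemma submean_value_bound (v : R -> R -> R) (r m L : R) :
  0 < r -> 0 <= m -> 0 <= L ->
  (forall a b, 0 <= a <= r -> -r <= b <= r -> v a b <= m) ->
  (forall a b, 0 <= a <= r -> -r <= b <= r -> v a b <= L * a) ->
  (forall a b rho, 0 < rho -> rho <= a -> a + rho <= r ->
     -r <= b - rho -> b + rho <= r ->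
     4 * v a b <= v (a + rho) b + v (a - rho) b + v a (b + rho) + v a (b - rho)
                  + L * rho ^ 3) ->
  forall a, 0 <= a <= r -> v a 0 <= 2 * m * a / r.
Proof.
  intros Hr Hm HL H0 H1 H2.
  set (q := m / r ^ 2).
  assert (Hr2 : 0 < r ^ 2) by (apply pow_lt, Hr).
  assert (Hq : 0 <= q) by (apply Rdiv_le_0_compat; lra).
  assert (Em : m = q * r ^ 2) by (unfold q; field; lra).
  set (C := L + 2 * q * r + 2 * (L + 1) * r ^ 2).
  assert (HC : forall rho, 0 < rho < r -> forall a b, 0 <= a <= r -> -r <= b <= r ->
     v a b - q * (b ^ 2 - a ^ 2 + 2 * a * r) + (L + 1) * rho * (a ^ 2 + b ^ 2)
     <= C * rho).
  { intros rho Hrho.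
    set (V := fun a b => v a b - q * (b ^ 2 - a ^ 2 + 2 * a * r)
                         + (L + 1) * rho * (a ^ 2 + b ^ 2)).
    assert (HLr : 0 <= (L + 1) * rho) by (apply Rmult_le_pos; lra).
    assert (HQ : forall a b, 0 <= a <= r -> -r <= b <= r ->
        (L + 1) * rho * (a ^ 2 + b ^ 2) <= 2 * (L + 1) * r ^ 2 * rho /\
        0 <= q * (b ^ 2 - a ^ 2 + 2 * a * r)).
    { intros a b Ha Hb. split.
      - replace (2 * (L + 1) * r ^ 2 * rho) with ((L + 1) * rho * (r ^ 2 + r ^ 2)) by ring.
        apply Rmult_le_compat_l; [exact HLr|]. nra.
      - apply Rmult_le_pos; [exact Hq|]. nra. }
    set (E := fun x => exists a b, 0 <= a <= r /\ -r <= b <= r /\ x = V a b).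
    destruct (completeness E) as [s [Hub Hlub]].
    { exists (m + 2 * (L + 1) * r ^ 2 * rho). intros x [a [b [Ha [Hb ->]]]].
      destruct (HQ a b Ha Hb). specialize (H0 a b Ha Hb). unfold V. lra. }
    { exists (V 0 0), 0, 0. repeat split; lra. }
    assert (Hs : s <= C * rho).
    { apply Rnot_lt_le. intros Hlt.
      assert (Hrho3 : 0 < rho ^ 3) by (apply pow_lt; lra).
      assert (Hp : exists a b, 0 <= a <= r /\ -r <= b <= r /\
                     C * rho < V a b /\ s - rho ^ 3 < V a b).
      { apply NNPP. intros Hn.
        assert (s <= Rmax (C * rho) (s - rho ^ 3)).
        { apply Hlub. intros x [a [b [Ha [Hb ->]]]]. apply Rnot_lt_le. intros HV.
          apply Hn. exists a, b. repeat split; try lra.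
          - eapply Rle_lt_trans; [apply Rmax_l|exact HV].
          - eapply Rle_lt_trans; [apply Rmax_r|exact HV]. }
        revert H. unfold Rmax. destruct (Rle_dec (C * rho) (s - rho ^ 3)); lra. }
      destruct Hp as [a [b [Ha [Hb [Hp1 Hp2]]]]].
      destruct (HQ a b Ha Hb) as [HQ1 HQ2].
      assert (HV : forall a b, 0 <= a <= r -> -r <= b <= r -> V a b <= s).
      { intros a' b' Ha' Hb'. apply Hub. exists a', b'. auto. }
      assert (Hqr : 0 <= q * r) by (apply Rmult_le_pos; lra).
      unfold C in Hp1.
      destruct (Rlt_or_le a rho) as [Ha1|Ha1].
      { specialize (H1 a b Ha Hb).
        assert (L * a <= L * rho) by (apply Rmult_le_compat_l; lra).
        assert (0 <= q * r * rho) by (apply Rmult_le_pos; lra).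
        unfold V in Hp1. lra. }
      assert (Hqq : forall x, r ^ 2 - 2 * r * rho <= x ->
                      m - 2 * (q * r * rho) <= q * x).
      { intros x Hx. rewrite Em.
        apply Rle_trans with (q * (r ^ 2 - 2 * r * rho)); [right; ring|].
        apply Rmult_le_compat_l; assumption. }
      assert (HLrho : 0 <= L * rho) by (apply Rmult_le_pos; lra).
      assert (H0' := H0 a b Ha Hb).
      destruct (Rlt_or_le r (a + rho)) as [Ha2|Ha2].
      { assert (m - 2 * (q * r * rho) <= q * (b ^ 2 - a ^ 2 + 2 * a * r))
          by (apply Hqq; nra).
        unfold V in Hp1. lra. }
      destruct (Rlt_or_le (b - rho) (- r)) as [Hb1|Hb1].
      { assert (m - 2 * (q * r * rho) <= q * (b ^ 2 - a ^ 2 + 2 * a * r))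
          by (apply Hqq; nra).
        unfold V in Hp1. lra. }
      destruct (Rlt_or_le r (b + rho)) as [Hb2|Hb2].
      { assert (m - 2 * (q * r * rho) <= q * (b ^ 2 - a ^ 2 + 2 * a * r))
          by (apply Hqq; nra).
        unfold V in Hp1. lra. }
      assert (K1 := HV (a + rho) b). assert (K2 := HV (a - rho) b).
      assert (K3 := HV a (b + rho)). assert (K4 := HV a (b - rho)).
      assert (K5 := H2 a b rho (proj1 Hrho) Ha1 Ha2 Hb1 Hb2).
      assert (HLr3 : 0 <= L * rho ^ 3) by (apply Rmult_le_pos; lra).
      assert (V (a + rho) b + V (a - rho) b + V a (b + rho) + V a (b - rho) <= 4 * s)
        by (specialize (K1 ltac:(lra) ltac:(lra)); specialize (K2 ltac:(lra) ltac:(lra));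
            specialize (K3 ltac:(lra) ltac:(lra)); specialize (K4 ltac:(lra) ltac:(lra)); lra).
      assert (V (a + rho) b + V (a - rho) b + V a (b + rho) + V a (b - rho) - 4 * V a b
              = v (a + rho) b + v (a - rho) b + v a (b + rho) + v a (b - rho) - 4 * v a b
                + 4 * ((L + 1) * rho ^ 3)) by (unfold V; ring).
      lra. }
    intros a b Ha Hb. eapply Rle_trans; [|exact Hs]. apply Hub. exists a, b. auto. }
  intros a Ha.
  assert (Hfin : v a 0 <= q * (2 * a * r - a ^ 2)).
  { apply le_epsilon. intros eps He.
    assert (HC0 : 0 <= C).
    { unfold C. assert (0 <= q * r) by (apply Rmult_le_pos; lra).
      assert (0 <= (L + 1) * r ^ 2) by (apply Rmult_le_pos; lra). lra. }
    set (rho := Rmin (r / 2) (eps / (C + 1))).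
    assert (Hd : 0 < eps / (C + 1)) by (apply Rdiv_lt_0_compat; lra).
    assert (Hrho : 0 < rho < r).
    { split; [apply Rmin_glb_lt; lra|].
      apply Rle_lt_trans with (r / 2); [apply Rmin_l|lra]. }
    specialize (HC rho Hrho a 0 Ha ltac:(lra)).
    assert (C * rho <= eps).
    { apply Rle_trans with (C * (eps / (C + 1))).
      - apply Rmult_le_compat_l; [lra|apply Rmin_r].
      - replace eps with ((C + 1) * (eps / (C + 1))) at 2 by (field; lra).
        apply Rmult_le_compat_r; lra. }
    assert (0 <= (L + 1) * rho * (a ^ 2 + 0 ^ 2))
      by (apply Rmult_le_pos; [apply Rmult_le_pos; lra|nra]).
    lra. }
  eapply Rle_trans; [exact Hfin|].
  apply Rle_trans with (q * (2 * a * r)).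
  - apply Rmult_le_compat_l; [exact Hq|]. nra.
  - right. rewrite Em. field. lra.
Qed.

(** * Complex differentiability and a Cauchy estimate *)

Definition is_cderiv {X : NormedModule C_AbsRing} (u : C -> X) (z : C) (y : X) : Prop :=
  forall eps, 0 < eps -> exists d, 0 < d /\ forall h : C, Cmod h < d ->
    norm (minus (minus (u (Cplus z h)) (u z)) (scal h y)) <= eps * Cmod h.

Lemma is_cderiv_shift (X : NormedModule C_AbsRing) (u : C -> X) (c z : C) (y : X) :
  is_cderiv u (Cminus z c) y -> is_cderiv (fun z => u (Cminus z c)) z y.
Proof.
  intros H eps He. destruct (H eps He) as [d [Hd H']]. exists d. split; [exact Hd|].
  intros h Hh. replace (Cminus (Cplus z h) c) with (Cplus (Cminus z c) h) by ring.
  apply H', Hh.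
Qed.

(** The mean value inequality for [u] minus the affine function of slope [c], along
    the segment from [z] to [z + k]. *)
Lemma cmean_value (X : NormedModule C_AbsRing) (u u1 : C -> X) (z k : C) (c : X)
    (N : R) :
  (forall s, 0 <= s <= 1 ->
     is_cderiv u (Cplus z (Cmult (RtoC s) k)) (u1 (Cplus z (Cmult (RtoC s) k)))) ->
  (forall s, 0 <= s <= 1 -> norm (minus (u1 (Cplus z (Cmult (RtoC s) k))) c) <= N) ->
  norm (minus (minus (u (Cplus z k)) (u z)) (scal k c)) <= Cmod k * N.
Proof.
  intros Hu HN.
  assert (Hk := Cmod_ge_0 k).
  assert (HN0 : 0 <= N) by exact (Rle_trans _ _ _ (norm_ge_0 _) (HN 0 ltac:(lra))).
  set (p := fun s => Cplus z (Cmult (RtoC s) k)).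
  set (f := fun s => minus (u (p s)) (scal (Cmult (RtoC s) k) c)).
  assert (Hloc : forall s eps, 0 <= s <= 1 -> 0 < eps -> exists d, 0 < d /\
            forall s', Rabs (s' - s) < d ->
              norm (minus (f s') (f s)) <= (Cmod k * N + eps) * Rabs (s' - s)).
  { intros s eps Hs He.
    destruct (Hu s Hs (eps / (Cmod k + 1))) as [d [Hd H]]; [apply Rdiv_lt_0_compat; lra|].
    exists (d / (Cmod k + 1)). split; [apply Rdiv_lt_0_compat; lra|].
    intros s' Hs'. set (h := Cmult (RtoC (s' - s)) k).
    assert (Eh : Cmod h = Rabs (s' - s) * Cmod k) by (unfold h; rewrite Cmod_mult, Cmod_R; reflexivity).
    assert (Hab := Rabs_pos (s' - s)).
    assert (Hh : Cmod h < d).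
    { rewrite Eh. apply Rle_lt_trans with (Rabs (s' - s) * (Cmod k + 1)).
      - apply Rmult_le_compat_l; lra.
      - apply Rmult_lt_reg_r with (/ (Cmod k + 1)); [apply Rinv_0_lt_compat; lra|].
        rewrite Rmult_assoc, Rinv_r, Rmult_1_r by lra. exact Hs'. }
    specialize (H h Hh). fold (p s) in H.
    replace (Cplus (p s) h) with (p s') in H
      by (unfold p, h; rewrite RtoC_minus; ring).
    replace (minus (f s') (f s)) with
      (plus (minus (minus (u (p s')) (u (p s))) (scal h (u1 (p s))))
            (scal h (minus (u1 (p s)) c)))
      by (unfold f, h; rewrite RtoC_minus; vring).
    eapply Rle_trans; [apply norm_triangle|]. rewrite norm_scalC.
    assert (HNs : norm (minus (u1 (p s)) c) <= N) by (apply HN, Hs).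
    assert (H1 : Cmod h * norm (minus (u1 (p s)) c) <= Cmod h * N)
      by (apply Rmult_le_compat_l; [apply Cmod_ge_0|exact HNs]).
    assert (H2 : eps / (Cmod k + 1) * Cmod h <= eps * Rabs (s' - s)).
    { rewrite Eh. replace (eps / (Cmod k + 1) * (Rabs (s' - s) * Cmod k))
        with (eps * Rabs (s' - s) * (Cmod k / (Cmod k + 1))) by (field; lra).
      rewrite <- (Rmult_1_r (eps * Rabs (s' - s))) at 2.
      apply Rmult_le_compat_l; [apply Rmult_le_pos; lra|].
      apply Rmult_le_reg_r with (Cmod k + 1); [lra|].
      unfold Rdiv. rewrite Rmult_assoc, Rinv_l by lra. lra. }
    assert (H3 : Cmod h * N = Cmod k * N * Rabs (s' - s)) by (rewrite Eh; ring).
    lra. }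
  assert (Hm : norm (minus (f 1) (f 0)) <= Cmod k * N * 1 - Cmod k * N * 0).
  { apply (mean_value_ineq X f (fun s => Cmod k * N * s)); [lra| | |].
    - intros s eps Hs He. destruct (Hloc s 1 Hs ltac:(lra)) as [d [Hd H]].
      assert (HkN : 0 <= Cmod k * N) by (apply Rmult_le_pos; assumption).
      exists (Rmin d (eps / (Cmod k * N + 1))). split.
      { apply Rmin_glb_lt; [exact Hd|apply Rdiv_lt_0_compat; lra]. }
      intros s' _ Hs'. eapply Rle_trans.
      { apply H. eapply Rlt_le_trans; [exact Hs'|apply Rmin_l]. }
      apply Rle_trans with ((Cmod k * N + 1) * (eps / (Cmod k * N + 1))).
      + apply Rmult_le_compat_l; [lra|]. left. eapply Rlt_le_trans; [exact Hs'|apply Rmin_r].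
      + right; field; lra.
    - intros s eps Hs He. assert (HkN : 0 <= Cmod k * N) by (apply Rmult_le_pos; assumption).
      exists (eps / (Cmod k * N + 1)). split; [apply Rdiv_lt_0_compat; lra|].
      intros s' _ Hs'. change (Rabs (Cmod k * N * s' - Cmod k * N * s) <= eps).
      rewrite <- Rmult_minus_distr_l, Rabs_mult, (Rabs_pos_eq _ HkN).
      apply Rle_trans with ((Cmod k * N + 1) * (eps / (Cmod k * N + 1))).
      + apply Rmult_le_compat; [exact HkN|apply Rabs_pos|lra|lra].
      + right; field; lra.
    - intros s eps Hs He. destruct (Hloc s eps ltac:(lra) He) as [d [Hd H]].
      exists d. split; [exact Hd|]. intros h Hh _.
      specialize (H (s + h)). replace (s + h - s) with h in H by ring.
      rewrite Rabs_pos_eq in H by lra. specialize (H (proj2 Hh)). lra. }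
  replace (minus (f 1) (f 0)) with (minus (minus (u (Cplus z k)) (u z)) (scal k c)) in Hm.
  - lra.
  - unfold f. replace (p 1) with (Cplus z k) by (unfold p; ring).
    replace (p 0) with z by (unfold p; ring). vring.
Qed.

Lemma norm_minus_zero (X : NormedModule C_AbsRing) (x : X) :
  norm (minus x zero) = norm x.
Proof. f_equal. vring. Qed.

Lemma taylor2 (X : NormedModule C_AbsRing) (u u1 u2 u3 : C -> X) (z k : C) (N : R) :
  (forall s, 0 <= s <= 1 -> let p := Cplus z (Cmult (RtoC s) k) in
     is_cderiv u p (u1 p) /\ is_cderiv u1 p (u2 p) /\ is_cderiv u2 p (u3 p) /\
     norm (u3 p) <= N) ->
  norm (minus (u (Cplus z k))
    (plus (u z) (plus (scal k (u1 z)) (scal (Cmult (Cmult k k) (RtoC (/ 2))) (u2 z)))))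
  <= N * Cmod k ^ 3.
Proof.
  intros H.
  assert (HN : 0 <= N).
  { destruct (H 0 ltac:(lra)) as [_ [_ [_ Hn]]]. exact (Rle_trans _ _ _ (norm_ge_0 _) Hn). }
  assert (Hk := Cmod_ge_0 k).
  assert (Hsub : forall s s', 0 <= s <= 1 -> 0 <= s' <= 1 -> 0 <= s' * s <= 1)
    by (intros; split; nra).
  assert (Hpt : forall s s', Cplus z (Cmult (RtoC s') (Cmult (RtoC s) k)) =
                             Cplus z (Cmult (RtoC (s' * s)) k))
    by (intros; rewrite RtoC_mult; ring).
  assert (Hsk : forall s, 0 <= s <= 1 -> Cmod (Cmult (RtoC s) k) <= Cmod k).
  { intros s Hs. rewrite Cmod_mult, Cmod_R, Rabs_pos_eq by lra. nra. }
  assert (H2 : forall s, 0 <= s <= 1 ->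
    norm (minus (u2 (Cplus z (Cmult (RtoC s) k))) (u2 z)) <= N * Cmod k).
  { intros s Hs.
    replace (minus (u2 (Cplus z (Cmult (RtoC s) k))) (u2 z)) with
      (minus (minus (u2 (Cplus z (Cmult (RtoC s) k))) (u2 z))
             (scal (Cmult (RtoC s) k) zero)) by vring.
    eapply Rle_trans; [apply (cmean_value X u2 u3) with (N := N)|].
    - intros s' Hs'. rewrite Hpt. apply H, Hsub; assumption.
    - intros s' Hs'. rewrite Hpt.
      rewrite norm_minus_zero.
      exact (proj2 (proj2 (proj2 (H _ (Hsub _ _ Hs Hs'))))).
    - rewrite Rmult_comm. apply Rmult_le_compat_l; [exact HN|apply Hsk, Hs]. }
  assert (H1 : forall s, 0 <= s <= 1 ->
    norm (minus (minus (u1 (Cplus z (Cmult (RtoC s) k))) (u1 z))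
            (scal (Cmult (RtoC s) k) (u2 z))) <= N * Cmod k * Cmod k).
  { intros s Hs. eapply Rle_trans; [apply (cmean_value X u1 u2) with (N := N * Cmod k)|].
    - intros s' Hs'. rewrite Hpt. apply H, Hsub; assumption.
    - intros s' Hs'. rewrite Hpt. apply H2, Hsub; assumption.
    - rewrite Rmult_comm. apply Rmult_le_compat_l; [apply Rmult_le_pos; assumption|apply Hsk, Hs]. }
  set (g := fun w => minus (u w)
       (scal (Cmult (Cmult (Cminus w z) (Cminus w z)) (RtoC (/ 2))) (u2 z))).
  set (g1 := fun w => minus (u1 w) (scal (Cminus w z) (u2 z))).
  assert (Hg : norm (minus (minus (g (Cplus z k)) (g z)) (scal k (u1 z)))
               <= Cmod k * (N * Cmod k * Cmod k)).
  { apply (cmean_value X g g1).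
    - intros s Hs. destruct (H s Hs) as [Hu _]. cbv zeta in Hu.
      set (p := Cplus z (Cmult (RtoC s) k)) in *.
      intros eps He. destruct (Hu (eps / 2)) as [d [Hd Hd']]; [lra|].
      assert (Hn := norm_ge_0 (u2 z)).
      assert (Hq : 0 < eps / (norm (u2 z) + 1)) by (apply Rdiv_lt_0_compat; lra).
      exists (Rmin d (eps / (norm (u2 z) + 1))). split; [apply Rmin_glb_lt; assumption|].
      intros h Hh. specialize (Hd' h (Rlt_le_trans _ _ _ Hh (Rmin_l _ _))).
      assert (Hh2 := Rlt_le_trans _ _ _ Hh (Rmin_r _ _)).
      replace (minus (minus (g (Cplus p h)) (g p)) (scal h (g1 p))) with
        (minus (minus (minus (u (Cplus p h)) (u p)) (scal h (u1 p)))
               (scal (Cmult (Cmult h h) (RtoC (/ 2))) (u2 z))).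
      2:{ unfold g, g1. rewrite RtoC_inv by lra. vlin; try ring.
          field. }
      eapply Rle_trans; [apply norm_minus_le|].
      rewrite norm_scalC, !Cmod_mult, Cmod_R, (Rabs_pos_eq (/ 2)) by lra.
      assert (Hhp := Cmod_ge_0 h).
      assert (Cmod h * norm (u2 z) <= eps).
      { apply Rle_trans with (eps / (norm (u2 z) + 1) * (norm (u2 z) + 1)).
        - apply Rmult_le_compat; lra.
        - right; field; lra. }
      assert (Cmod h * (Cmod h * norm (u2 z)) <= Cmod h * eps)
        by (apply Rmult_le_compat_l; assumption).
      lra.
    - intros s Hs.
      replace (minus (g1 (Cplus z (Cmult (RtoC s) k))) (u1 z)) with
        (minus (minus (u1 (Cplus z (Cmult (RtoC s) k))) (u1 z))
            (scal (Cmult (RtoC s) k) (u2 z))) by (unfold g1; vring).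
      apply H1, Hs. }
  replace (minus (u (Cplus z k))
    (plus (u z) (plus (scal k (u1 z)) (scal (Cmult (Cmult k k) (RtoC (/ 2))) (u2 z)))))
    with (minus (minus (g (Cplus z k)) (g z)) (scal k (u1 z)))
    by (unfold g; vring).
  lra.
Qed.

(** The first and second order terms of the Taylor expansions in the four
    directions [rho], [- rho], [i rho], [- i rho] cancel. *)
Lemma four_point_mean_value (X : NormedModule C_AbsRing) (u u1 u2 u3 : C -> X)
    (z : C) (rho N : R) :
  0 < rho ->
  (forall p, Cmod (Cminus p z) <= rho ->
     is_cderiv u p (u1 p) /\ is_cderiv u1 p (u2 p) /\ is_cderiv u2 p (u3 p) /\
     norm (u3 p) <= N) ->
  norm (minus (plus (plus (u (Cplus z (rho, 0))) (u (Cplus z (- rho, 0))))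
                    (plus (u (Cplus z (0, rho))) (u (Cplus z (0, - rho)))))
              (scal (RtoC 4) (u z))) <= 4 * N * rho ^ 3.
Proof.
  intros Hrho H.
  assert (HT : forall k, Cmod k = rho ->
    norm (minus (u (Cplus z k)) (plus (u z) (plus (scal k (u1 z))
       (scal (Cmult (Cmult k k) (RtoC (/ 2))) (u2 z))))) <= N * rho ^ 3).
  { intros k Hk. rewrite <- Hk. apply taylor2 with (u3 := u3).
    intros s Hs p. apply H. unfold p.
    replace (Cminus (Cplus z (Cmult (RtoC s) k)) z) with (Cmult (RtoC s) k) by ring.
    rewrite Cmod_mult, Cmod_R, Rabs_pos_eq, Hk by lra. nra. }
  assert (Hc : forall k x y, k = (x, y) -> x ^ 2 + y ^ 2 = rho ^ 2 -> Cmod k = rho).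
  { intros k x y -> E. unfold Cmod; cbn [fst snd]. rewrite E.
    apply sqrt_pow2; lra. }
  assert (H1 := HT (rho, 0) (Hc _ rho 0 eq_refl ltac:(ring))).
  assert (H2 := HT (- rho, 0) (Hc _ (- rho) 0 eq_refl ltac:(ring))).
  assert (H3 := HT (0, rho) (Hc _ 0 rho eq_refl ltac:(ring))).
  assert (H4 := HT (0, - rho) (Hc _ 0 (- rho) eq_refl ltac:(ring))).
  set (k1 := (rho, 0) : C) in *. set (k2 := (- rho, 0) : C) in *.
  set (k3 := (0, rho) : C) in *. set (k4 := (0, - rho) : C) in *.
  set (e := (fun k => minus (u (Cplus z k)) (plus (u z) (plus (scal k (u1 z))
       (scal (Cmult (Cmult k k) (RtoC (/ 2))) (u2 z))))) : C -> X) in *.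
  assert (E1 : k2 = Copp k1) by (apply injective_projections; simpl; ring).
  assert (E3 : k4 = Copp k3) by (apply injective_projections; simpl; ring).
  assert (E2 : Cmult k3 k3 = Copp (Cmult k1 k1))
    by (apply injective_projections; simpl; ring).
  replace (minus _ _) with (plus (plus (e k1) (e k2)) (plus (e k3) (e k4))).
  - assert (T1 := norm_triangle (plus (e k1) (e k2)) (plus (e k3) (e k4))).
    assert (T2 := norm_triangle (e k1) (e k2)).
    assert (T3 := norm_triangle (e k3) (e k4)).
    change (norm (e k1) <= N * rho ^ 3) in H1. change (norm (e k2) <= N * rho ^ 3) in H2.
    change (norm (e k3) <= N * rho ^ 3) in H3. change (norm (e k4) <= N * rho ^ 3) in H4.
    lra.
  - unfold e. rewrite E1, E3. vlin; try ring.
    replace (Cmult (Copp k3) (Copp k3)) with (Cmult k3 k3) by ring.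
    rewrite !E2. ring.
Qed.

Lemma Cmod_pair_le (x y : R) : Cmod (x, y) <= Rabs x + Rabs y.
Proof.
  replace ((x, y) : C) with (Cplus (x, 0) (0, y))
    by (apply injective_projections; simpl; ring).
  eapply Rle_trans; [apply Cmod_triangle|].
  apply Rplus_le_compat; unfold Cmod; cbn [fst snd].
  - replace (x ^ 2 + 0 ^ 2) with (Rsqr x) by (unfold Rsqr; ring). rewrite sqrt_Rsqr_abs; lra.
  - replace (0 ^ 2 + y ^ 2) with (Rsqr y) by (unfold Rsqr; ring). rewrite sqrt_Rsqr_abs; lra.
Qed.

(** The difference [u (t + a + i b) - u (t - a + i b)] vanishes for [a = 0], and by
    the mean value property of [u] its norm is sub-mean-valued up to an error of
    third order; so it is at most [4 M a / r] on the real axis. This replaces Cauchy's integral formula. *)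
Lemma cauchy_estimate (X : NormedModule C_AbsRing) (u u1 u2 u3 : C -> X)
    (t r M N : R) :
  0 < r ->
  (forall p, Rabs (Re p - t) <= r -> Rabs (Im p) <= r ->
     is_cderiv u p (u1 p) /\ is_cderiv u1 p (u2 p) /\ is_cderiv u2 p (u3 p) /\
     norm (u p) <= M /\ norm (u1 p) <= N /\ norm (u3 p) <= N) ->
  norm (u1 (RtoC t)) <= 2 * M / r.
Proof.
  intros Hr H.
  assert (H' : forall x y, - r <= x <= r -> - r <= y <= r ->
     let p := (t + x, y) : C in
     is_cderiv u p (u1 p) /\ is_cderiv u1 p (u2 p) /\ is_cderiv u2 p (u3 p) /\
     norm (u p) <= M /\ norm (u1 p) <= N /\ norm (u3 p) <= N).
  { intros x y Hx Hy p. apply H; unfold p; simpl; apply Rabs_le; lra. }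
  assert (H0 := H' 0 0 ltac:(lra) ltac:(lra)). cbv zeta in H0.
  rewrite Rplus_0_r in H0. fold (RtoC t) in H0.
  destruct H0 as [Hd [_ [_ [HM [HN _]]]]].
  assert (HM0 := Rle_trans _ _ _ (norm_ge_0 _) HM).
  assert (HN0 := Rle_trans _ _ _ (norm_ge_0 _) HN).
  set (w := (fun a b => minus (u (t + a, b)) (u (t - a, b))) : R -> R -> X).
  assert (Hw : forall a, 0 <= a <= r -> norm (w a 0) <= 2 * (2 * M) * a / r).
  { apply (submean_value_bound (fun a b => norm (w a b)) r (2 * M) (8 * N)); try lra.
    - intros a b Ha Hb. unfold w. eapply Rle_trans; [apply norm_minus_le|].
      destruct (H' a b) as [_ [_ [_ [K1 _]]]]; [lra|lra|].
      destruct (H' (- a) b) as [_ [_ [_ [K2 _]]]]; [lra|lra|].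
      change (t + - a) with (t - a) in K2. lra.
    - intros a b Ha Hb. unfold w.
      assert (K := cmean_value X u u1 (t - a, b) (RtoC (2 * a)) zero N).
      replace (Cplus (t - a, b) (RtoC (2 * a))) with ((t + a, b) : C) in K
        by (apply injective_projections; simpl; ring).
      rewrite Cmod_R, Rabs_pos_eq in K by lra.
      assert (Ep : forall s, Cplus (t - a, b) (Cmult (RtoC s) (RtoC (2 * a))) =
                   (t + (s * (2 * a) - a), b))
        by (intros; apply injective_projections; simpl; ring).
      assert (Hs2 : forall s, 0 <= s <= 1 -> - r <= s * (2 * a) - a <= r)
        by (intros; split; nra).
      assert (K' : norm (minus (minus (u (t + a, b)) (u (t - a, b)))
                               (scal (RtoC (2 * a)) zero)) <= 2 * a * N).
      { apply K.
        - intros s Hs. rewrite Ep. apply H'; [apply Hs2, Hs|lra].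
        - intros s Hs. rewrite Ep, norm_minus_zero. apply H'; [apply Hs2, Hs|lra]. }
      rewrite (scal_zero_r (V := X)), norm_minus_zero in K'.
      assert (0 <= N * a) by (apply Rmult_le_pos; lra). lra.
    - intros a b rho Hrho Ha1 Ha2 Hb1 Hb2.
      assert (HF : forall x, - r <= x - rho -> x + rho <= r ->
         norm (minus (plus (plus (u (t + (x + rho), b)) (u (t + (x - rho), b)))
                    (plus (u (t + x, b + rho)) (u (t + x, b - rho))))
              (scal (RtoC 4) (u (t + x, b)))) <= 4 * N * rho ^ 3).
      { intros x Hx1 Hx2.
        assert (K := four_point_mean_value X u u1 u2 u3 (t + x, b) rho N Hrho).
        replace (Cplus (t + x, b) (rho, 0)) with ((t + (x + rho), b) : C) in K
          by (apply injective_projections; simpl; ring).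
        replace (Cplus (t + x, b) (- rho, 0)) with ((t + (x - rho), b) : C) in K
          by (apply injective_projections; simpl; ring).
        replace (Cplus (t + x, b) (0, rho)) with ((t + x, b + rho) : C) in K
          by (apply injective_projections; simpl; ring).
        replace (Cplus (t + x, b) (0, - rho)) with ((t + x, b - rho) : C) in K
          by (apply injective_projections; simpl; ring).
        apply K. intros p Hp.
        assert (P := Rle_trans _ _ _ (Rmax_Cmod (Cminus p (t + x, b))) Hp).
        assert (P1 := Rle_trans _ _ _ (Rmax_l _ _) P).
        assert (P2 := Rle_trans _ _ _ (Rmax_r _ _) P).
        simpl in P1, P2. apply Rabs_le_between in P1. apply Rabs_le_between in P2.
        destruct (H p) as [Q1 [Q2 [Q3 [_ [_ Q4]]]]]; [| |auto];
          apply Rabs_le; unfold Re, Im; lra. }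
      assert (F1 := HF a ltac:(lra) ltac:(lra)).
      assert (F2 := HF (- a) ltac:(lra) ltac:(lra)).
      replace (t + (- a + rho)) with (t - (a - rho)) in F2 by ring.
      replace (t + (- a - rho)) with (t - (a + rho)) in F2 by ring.
      change (t + - a) with (t - a) in F2.
      set (e1 := minus (plus (plus (u (t + (a + rho), b)) (u (t + (a - rho), b)))
                    (plus (u (t + a, b + rho)) (u (t + a, b - rho))))
              (scal (RtoC 4) (u (t + a, b))) : X) in *.
      set (e2 := minus (plus (plus (u (t - (a - rho), b)) (u (t - (a + rho), b)))
                    (plus (u (t - a, b + rho)) (u (t - a, b - rho))))
              (scal (RtoC 4) (u (t - a, b))) : X) in *.
      rewrite <- norm_scalR by lra.
      assert (E : scal (RtoC 4) (w a b) =
        minus (plus (plus (w (a + rho) b) (w (a - rho) b))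
                    (plus (w a (b + rho)) (w a (b - rho)))) (minus e1 e2))
        by (unfold e1, e2, w; vring).
      rewrite E. eapply Rle_trans; [apply norm_minus_le|].
      assert (T1 := norm_minus_le X e1 e2).
      assert (T2 := norm_triangle (plus (w (a + rho) b) (w (a - rho) b))
                    (plus (w a (b + rho)) (w a (b - rho)))).
      assert (T3 := norm_triangle (w (a + rho) b) (w (a - rho) b)).
      assert (T4 := norm_triangle (w a (b + rho)) (w a (b - rho))).
      lra. }
  apply le_epsilon. intros eps He.
  destruct (Hd eps He) as [d [Hd0 Hdd]].
  set (a := Rmin (d / 2) r).
  assert (Ha : 0 < a <= r /\ a < d).
  { unfold a, Rmin; destruct (Rle_dec (d / 2) r); lra. }
  assert (D1 := Hdd (RtoC a)). assert (D2 := Hdd (RtoC (- a))).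
  rewrite Cmod_R, Rabs_pos_eq in D1 by lra.
  rewrite Cmod_R, Rabs_Ropp, Rabs_pos_eq in D2 by lra.
  specialize (D1 ltac:(lra)). specialize (D2 ltac:(lra)).
  specialize (Hw a ltac:(lra)). unfold w in Hw.
  replace ((t + a, 0) : C) with (Cplus (RtoC t) (RtoC a)) in Hw
    by (apply injective_projections; simpl; ring).
  replace ((t - a, 0) : C) with (Cplus (RtoC t) (RtoC (- a))) in Hw
    by (apply injective_projections; simpl; ring).
  set (up := u (Cplus (RtoC t) (RtoC a))) in *.
  set (um := u (Cplus (RtoC t) (RtoC (- a)))) in *.
  set (y := u1 (RtoC t)) in *. set (x := u (RtoC t)) in *.
  set (f1 := minus (minus up x) (scal (RtoC a) y) : X) in *.
  set (f2 := minus (minus um x) (scal (RtoC (- a)) y) : X) in *.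
  assert (E : scal (RtoC (2 * a)) y = plus (minus up um) (minus f2 f1)).
  { unfold f1, f2. rewrite RtoC_mult, RtoC_opp. vring. }
  assert (K : 2 * a * norm y <= 2 * a * (2 * M / r + eps)).
  { rewrite <- norm_scalR by lra. rewrite E.
    eapply Rle_trans; [apply norm_triangle|].
    assert (T := norm_minus_le X f2 f1).
    replace (2 * a * (2 * M / r + eps)) with (2 * (2 * M) * a / r + 2 * eps * a)
      by (field; lra).
    lra. }
  apply Rmult_le_reg_l in K; lra.
Qed.

(** * Derivative bound for holomorphic semigroups *)

(** A sector in Cartesian coordinates, where membership is a linear inequality. *)
Definition cone (kappa : R) (z : C) : Prop :=
  0 < Re z /\ Rabs (Im z) <= kappa * Re z.

Lemma cone_real (kappa t : R) : 0 < kappa -> 0 < t -> cone kappa (RtoC t).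
Proof.
  intros Hk Ht. split; [exact Ht|]. simpl. rewrite Rabs_R0.
  apply Rmult_le_pos; lra.
Qed.

Lemma cone_near_real (kappa t : R) (h : C) :
  0 < kappa <= 1 -> Cmod h < kappa * t / 2 -> cone kappa (Cplus (RtoC t) h).
Proof.
  intros Hk Hh.
  assert (P := Rle_lt_trans _ _ _ (Rmax_Cmod h) Hh).
  assert (P1 := Rle_lt_trans _ _ _ (Rmax_l _ _) P).
  assert (P2 := Rle_lt_trans _ _ _ (Rmax_r _ _) P).
  assert (Ht : 0 < t).
  { assert (0 < kappa * t) by (assert (Hp := Rabs_pos (fst h)); lra).
    apply (Rmult_lt_reg_l kappa); lra. }
  assert (H1 : kappa * t <= t) by nra.
  apply Rabs_def2 in P1. unfold cone, Re, Im; simpl. split; [lra|].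
  replace (0 + snd h) with (snd h) by ring.
  apply Rle_trans with (kappa * (t / 2)); [lra|apply Rmult_le_compat_l; lra].
Qed.

(** If [L] is the derivative of [U] at the real point [t0], then [U w L] is the
    derivative at [t0 + w]; so three derivatives of [U z x] near [t] are values of
    [U] in the cone applied to fixed vectors. *)
Lemma holomorphic_semigroup_derivative_bound (X : NormedModule C_AbsRing)
    (U : C -> X -> X) (kappa M eta : R) :
  0 < kappa <= 1 ->
  (forall z, cone kappa z -> is_linear (U z)) ->
  (forall z w x, cone kappa z -> cone kappa w -> U (Cplus z w) x = U z (U w x)) ->
  (forall t, 0 < t -> exists L, is_linear L /\
     forall x, is_cderiv (fun z => U z x) (RtoC t) (L x)) ->
  (forall z x, cone kappa z -> Cmod z < eta -> norm (U z x) <= M * norm x) ->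
  forall t, 0 < t < eta / 2 -> forall x, exists y,
    is_cderiv (fun z => U z x) (RtoC t) y /\ norm y <= 8 * M / kappa / t * norm x.
Proof.
  intros Hk Hlin Hsg Hder HM t Ht x.
  set (t0 := t / 6).
  destruct (Hder t0) as [L [HL HLd]]; [unfold t0; lra|].
  assert (HM0 : forall y : X, 0 <= M * norm y).
  { intros y. refine (Rle_trans _ _ _ (norm_ge_0 _) (HM (RtoC t) y _ _)).
    - apply cone_real; lra.
    - rewrite Cmod_R, Rabs_pos_eq; lra. }
  assert (HD : forall w y, cone kappa (Cminus w (RtoC t0)) ->
     is_cderiv (fun z => U z y) w (U (Cminus w (RtoC t0)) (L y))).
  { intros w y Hw. set (v := Cminus w (RtoC t0)) in *.
    replace w with (Cplus v (RtoC t0)) by (unfold v; ring).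
    destruct (linear_norm (U v) (Hlin v Hw)) as [K [HK1 HK2]].
    intros eps He. destruct (HLd y (eps / K)) as [d [Hd H]].
    { apply Rdiv_lt_0_compat; assumption. }
    exists (Rmin d (kappa * t0 / 2)). split.
    { apply Rmin_glb_lt; [exact Hd|]. apply Rdiv_lt_0_compat; [|lra].
      apply Rmult_lt_0_compat; unfold t0; lra. }
    intros h Hh. specialize (H h (Rlt_le_trans _ _ _ Hh (Rmin_l _ _))).
    assert (Hc := cone_near_real kappa t0 h Hk (Rlt_le_trans _ _ _ Hh (Rmin_r _ _))).
    replace (Cplus (Cplus v (RtoC t0)) h) with (Cplus v (Cplus (RtoC t0) h)) by ring.
    rewrite (Hsg v _ y Hw Hc), (Hsg v (RtoC t0) y Hw) by (apply cone_real; unfold t0; lra).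
    rewrite <- (linear_scal _ (Hlin v Hw)), <- !(linear_minus _ _ _ (Hlin v Hw)).
    eapply Rle_trans; [apply HK2|].
    apply Rle_trans with (K * (eps / K * Cmod h)).
    - apply Rmult_le_compat_l; [lra|exact H].
    - right; field; lra. }
  set (u := fun z => U z x).
  set (u1 := fun z => U (Cminus z (RtoC t0)) (L x)).
  set (u2 := fun z => U (Cminus (Cminus z (RtoC t0)) (RtoC t0)) (L (L x))).
  set (u3 := fun z => U (Cminus (Cminus (Cminus z (RtoC t0)) (RtoC t0)) (RtoC t0))
                        (L (L (L x)))).
  set (r := kappa * t / 4).
  assert (Hkt : 0 < kappa * t <= t)
    by (split; [apply Rmult_lt_0_compat; lra|nra]).
  set (N := Rmax (M * norm (L x)) (M * norm (L (L (L x))))).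
  exists (u1 (RtoC t)). split.
  { apply HD. rewrite <- RtoC_minus. apply cone_real; unfold t0; lra. }
  replace (8 * M / kappa / t * norm x) with (2 * (M * norm x) / r)
    by (unfold r; field; lra).
  apply (cauchy_estimate X u u1 u2 u3 t r (M * norm x) N); [unfold r; lra|].
  intros p Hp1 Hp2. apply Rabs_le_between in Hp1.
  (* [r] is so small that shifting the square of half side [r] around [t] by up to
     three steps [t0] to the left leaves it in the cone. *)
  assert (Hcone : forall q c, Re q = Re p - c -> Im q = Im p -> 0 <= c <= t / 2 ->
                    cone kappa q /\ Cmod q < eta).
  { intros q c E1 E2 Hc. unfold cone. rewrite E1, E2.
    assert (Hre : t / 4 <= Re p - c <= t + t / 4) by (unfold r in Hp1; lra).
    split; [split|].
    - lra.
    - eapply Rle_trans; [exact Hp2|].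
      apply Rle_trans with (kappa * (t / 4)); [unfold r; lra|].
      apply Rmult_le_compat_l; lra.
    - rewrite (surjective_pairing q).
      eapply Rle_lt_trans; [apply Cmod_pair_le|].
      change (fst q) with (Re q). change (snd q) with (Im q).
      rewrite E1, E2, (Rabs_pos_eq (Re p - c)) by lra.
      unfold r in Hp2. lra. }
  destruct (Hcone p 0) as [C0 B0]; [simpl; lra|reflexivity|lra|].
  destruct (Hcone (Cminus p (RtoC t0)) t0) as [C1 B1];
    [simpl; unfold Re; ring|simpl; unfold Im; ring|unfold t0; lra|].
  destruct (Hcone (Cminus (Cminus p (RtoC t0)) (RtoC t0)) (2 * t0)) as [C2 B2];
    [simpl; unfold Re; ring|simpl; unfold Im; ring|unfold t0; lra|].
  destruct (Hcone (Cminus (Cminus (Cminus p (RtoC t0)) (RtoC t0)) (RtoC t0)) (3 * t0))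
    as [C3 B3]; [simpl; unfold Re; ring|simpl; unfold Im; ring|unfold t0; lra|].
  split; [apply HD, C1|]. split.
  { apply (is_cderiv_shift X (fun z => U z (L x)) (RtoC t0)). apply HD, C2. }
  split.
  { apply (is_cderiv_shift X (fun z => U (Cminus z (RtoC t0)) (L (L x))) (RtoC t0)).
    apply (is_cderiv_shift X (fun z => U z (L (L x))) (RtoC t0)). apply HD, C3. }
  split; [apply HM; assumption|]. split.
  - eapply Rle_trans; [apply HM; assumption|apply Rmax_l].
  - eapply Rle_trans; [apply HM; assumption|apply Rmax_r].
Qed.

Lemma cone_in_sector (delta : R) :
  0 < delta <= PI / 2 ->
  exists kappa, 0 < kappa <= 1 /\ forall z, cone kappa z -> sector (delta / 2) z.
Proof.
  intros Hd. assert (HPI := PI_RGT_0). exists (tan (delta / 4)). split.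
  { split; [apply tan_gt_0; lra|]. rewrite <- tan_PI4. left.
    apply tan_increasing; lra. }
  intros [p q] [H1 H2]; simpl in H1, H2.
  set (y := q / p).
  assert (Hy : - tan (delta / 4) <= y <= tan (delta / 4)).
  { apply Rabs_le_between. unfold y, Rdiv. rewrite Rabs_mult, Rabs_inv, (Rabs_pos_eq p) by lra.
    apply Rmult_le_reg_r with p; [exact H1|].
    rewrite Rmult_assoc, Rinv_l by lra. lra. }
  assert (Hmon : forall a b, a <= b -> atan a <= atan b).
  { intros a b [H|<-]; [left; apply atan_increasing, H|lra]. }
  assert (Hat : atan (tan (delta / 4)) = delta / 4) by (apply atan_tan; lra).
  assert (A1 := Hmon _ _ (proj1 Hy)). assert (A2 := Hmon _ _ (proj2 Hy)).
  rewrite atan_opp, Hat in A1. rewrite Hat in A2.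
  assert (Hs : 0 < sqrt (1 + y²)) by (apply sqrt_lt_R0; assert (0 <= y²) by apply Rle_0_sqr; lra).
  exists (p * sqrt (1 + y²)), (atan y).
  split; [apply Rmult_lt_0_compat; assumption|].
  split; [apply Rle_lt_trans with (delta / 4); [apply Rabs_le; lra|lra]|].
  rewrite cos_atan, sin_atan. f_equal.
  - field. lra.
  - unfold y at 2. field. lra.
Qed.

(** * Semigroups and generators *)

Lemma at_right_0 (P : R -> Prop) :
  at_right 0 P <-> exists d, 0 < d /\ forall h, 0 < h < d -> P h.
Proof.
  split.
  - intros [d Hd]. exists d. split; [apply cond_pos|]. intros h Hh.
    apply Hd; [|lra]. change (Rabs (h - 0) < d). apply Rabs_def1; lra.
  - intros [d [Hd H]]. exists (mkposreal d Hd). intros h Hh Hp.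
    change (Rabs (h - 0) < d) in Hh. apply Rabs_def2 in Hh. apply H; lra.
Qed.

Lemma opnorm_le (X : NormedModule C_AbsRing) (L : X -> X) (c : R) (x : X) :
  (forall k x, L (scal k x) = scal k (L x)) -> Rbar_le (opnorm L) c -> norm (L x) <= c * norm x.
Proof.
  intros HL Hc.
  destruct (norm_ge_0 x) as [Hx|Hx].
  - assert (H : Rbar_le (/ norm x * norm (L x)) (opnorm L)).
    { apply (proj1 (Lub_Rbar_correct _)).
      assert (Hk : 0 <= / norm x) by (left; apply Rinv_0_lt_compat, Hx).
      exists (scal (RtoC (/ norm x)) x). split.
      - rewrite norm_scalR by exact Hk. right. field. lra.
      - rewrite HL, norm_scalR by exact Hk. reflexivity. }
    assert (H' := Rbar_le_trans _ _ _ H Hc). simpl in H'.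
    apply Rmult_le_reg_l with (/ norm x); [apply Rinv_0_lt_compat, Hx|].
    replace (/ norm x * (c * norm x)) with c by (field; lra). exact H'.
  - rewrite <- Hx. symmetry in Hx. apply norm_eq_zero in Hx. subst x.
    assert (E : L zero = zero).
    { transitivity (L (scal (RtoC 0) zero)); [f_equal; vring|]. rewrite HL. vring. }
    rewrite E, norm_zero. lra.
Qed.

Lemma le_opnorm (X : NormedModule C_AbsRing) (L : X -> X) (c : R) :
  0 <= c -> (forall x, norm (L x) <= c * norm x) -> Rbar_le (opnorm L) c.
Proof.
  intros Hc H. apply (proj2 (Lub_Rbar_correct _)).
  intros r [x [Hx ->]]. simpl. eapply Rle_trans; [apply H|]. nra.
Qed.

Definition right_derivative_at_0 {X : NormedModule C_AbsRing} (T : R -> X -> X)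
    (x y : X) : Prop :=
  forall eps, 0 < eps -> exists d, 0 < d /\ forall h, 0 < h < d ->
    norm (minus (minus (T h x) x) (scal (RtoC h) y)) <= eps * h.

Lemma generates_right_derivative (X : NormedModule C_AbsRing) (A : operator X)
    (T : R -> X -> X) (x y : X) :
  generates A T -> (dom A x /\ app A x = y) <-> right_derivative_at_0 T x y.
Proof.
  intros [_ H]. rewrite H, (filterlim_norm_iff R X (at_right 0)).
  assert (E : forall h, 0 < h ->
    norm (minus (minus (T h x) x) (scal (RtoC h) y)) =
    h * norm (minus (scal (RtoC (/ h)) (minus (T h x) x)) y)).
  { intros h Hh. rewrite <- norm_scalR by lra. f_equal.
    rewrite RtoC_inv by lra. vlin; field; intros E; apply RtoC_inj in E; lra. }
  split; intros K eps He.
  - specialize (K eps He). apply at_right_0 in K. destruct K as [d [Hd K]].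
    exists d. split; [exact Hd|]. intros h Hh. rewrite E, Rmult_comm by lra.
    apply Rmult_le_compat_r; [lra|]. left. apply K, Hh.
  - apply at_right_0. destruct (K (eps / 2)) as [d [Hd K']]; [lra|].
    exists d. split; [exact Hd|]. intros h Hh. specialize (K' h Hh).
    rewrite E in K' by lra. rewrite (Rmult_comm (eps / 2)) in K'.
    apply Rmult_le_reg_l in K'; [|lra].
    apply Rle_lt_trans with (1 := K'). lra.
Qed.

Lemma C0_right_continuous (X : NormedModule C_AbsRing) (T : R -> X -> X) (x : X) :
  C0_semigroup T -> forall eps, 0 < eps -> exists d, 0 < d /\
    forall h, 0 <= h < d -> norm (minus (T h x) x) < eps.
Proof.
  intros [_ [H0 [_ H]]] eps He. specialize (H x).
  rewrite (filterlim_norm_iff R X (at_right 0)) in H.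
  specialize (H eps He). apply at_right_0 in H. destruct H as [d [Hd H]].
  exists d. split; [exact Hd|]. intros h [[Hh|<-] Hh'].
  - apply H; lra.
  - rewrite H0, norm_minus_diag. exact He.
Qed.

Lemma C0_locally_bounded (X : NormedModule C_AbsRing) (T : R -> X -> X) :
  sequentially_complete X -> C0_semigroup T ->
  forall a, exists K, 1 <= K /\ forall t x, 0 <= t <= a -> norm (T t x) <= K * norm x.
Proof.
  intros HX HT.
  destruct (local_uniform_boundedness X {t : R | 0 <= t} (fun t => proj1_sig t)
              (fun t => T (proj1_sig t))) as [M [eta [HM [He H]]]].
  - exact HX.
  - intros [t Ht]; simpl. apply HT, Ht.
  - intros x. destruct (C0_right_continuous X T x HT 1 Rlt_0_1) as [d [Hd H]].
    exists (norm x + 1), d. split; [exact Hd|]. intros [t Ht]; simpl. intros Htd.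
    assert (N := norm_le_minus X (T t x) x). specialize (H t (conj Ht Htd)). lra.
  - assert (HK : forall n : nat, exists K, 1 <= K /\
      forall t x, 0 <= t <= INR n * (eta / 2) -> norm (T t x) <= K * norm x).
    { induction n as [|n [K [HK1 HK2]]].
      - exists 1. split; [lra|]. intros t x Ht. simpl in Ht.
        replace t with 0 by lra. rewrite (proj1 (proj2 HT)). lra.
      - exists (K * Rmax 1 M). assert (H1 := Rmax_l 1 M).
        split; [nra|]. intros t x Ht. rewrite S_INR in Ht.
        assert (Hn := norm_ge_0 x).
        destruct (Rle_or_lt t (INR n * (eta / 2))) as [Hl|Hl].
        + eapply Rle_trans; [apply HK2; lra|]. apply Rmult_le_compat_r; [exact Hn|nra].
        + replace t with (INR n * (eta / 2) + (t - INR n * (eta / 2))) by ring.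
          assert (H2 : 0 <= INR n * (eta / 2))
            by (apply Rmult_le_pos; [apply pos_INR|lra]).
          assert (H3 : 0 <= t - INR n * (eta / 2)) by lra.
          rewrite (proj1 (proj2 (proj2 HT))) by assumption.
          eapply Rle_trans; [apply HK2; lra|]. rewrite Rmult_assoc.
          apply Rmult_le_compat_l; [lra|].
          eapply Rle_trans; [apply (H (exist _ _ H3)); simpl; lra|].
          apply Rmult_le_compat_r; [exact Hn|apply Rmax_r]. }
    intros a. destruct (INR_archimed (eta / 2) a) as [n Hn]; [lra|].
    destruct (HK n) as [K [HK1 HK2]]. exists K. split; [exact HK1|].
    intros t x Ht. apply HK2. lra.
Qed.

Lemma strongly_stable_bounded (X : NormedModule C_AbsRing) (S : R -> X -> X) :
  sequentially_complete X -> C0_semigroup S -> strongly_stable S ->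
  exists M t0, 0 < M /\ forall t x, t0 <= t -> 0 < t -> norm (S t x) <= M * norm x.
Proof.
  intros HX HS Hst.
  destruct (local_uniform_boundedness X {t : R | 0 < t} (fun t => / proj1_sig t)
              (fun t => S (proj1_sig t))) as [M [eta [HM [He H]]]].
  - exact HX.
  - intros [t Ht]; simpl. apply HS; lra.
  - intros x. specialize (Hst x). apply is_lim_spec in Hst.
    destruct (Hst (mkposreal 1 Rlt_0_1)) as [a Ha]. simpl in Ha.
    assert (Hp : 0 < Rabs a + 1) by (assert (P := Rabs_pos a); lra).
    exists 1, (/ (Rabs a + 1)). split; [apply Rinv_0_lt_compat, Hp|].
    intros [t Ht]; simpl. intros Hlt.
    apply Rinv_lt_cancel in Hlt; [|exact Ht].
    specialize (Ha t). rewrite Rminus_0_r, Rabs_pos_eq in Ha by apply norm_ge_0.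
    left. apply Ha. assert (P := Rle_abs a). lra.
  - exists M, (2 / eta). split; [exact HM|]. intros t x Ht Ht0.
    apply (H (exist _ _ Ht0)). simpl.
    apply Rmult_lt_reg_r with t; [exact Ht0|]. rewrite Rinv_l by lra.
    apply Rmult_le_compat_l with (r := eta) in Ht; [|lra].
    replace (eta * (2 / eta)) with 2 in Ht by (field; lra). lra.
Qed.

(** The extension [U] is strongly continuous at the vertex of a smaller sector, so
    uniform boundedness provides the bound on [U] near 0 that the derivative
    estimate needs; the derivative of [U] at a real point [t] is [A T(t)]. *)
Lemma analytic_semigroup_smoothing (X : NormedModule C_AbsRing) (A : operator X)
    (T : R -> X -> X) :
  sequentially_complete X -> generates A T -> analytic_semigroup T ->
  (forall t x, 0 < t -> dom A (T t x)) /\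
  exists K s0, 0 < K /\ 0 < s0 /\ forall t x, 0 < t < s0 ->
    norm (app A (T t x)) <= K / t * norm x.
Proof.
  intros HX HA [HT [delta [U [Hdelta [HU0 [HU1 [HU2 [HU3 HU4]]]]]]]].
  destruct (cone_in_sector delta Hdelta) as [kappa [Hk Hcs]].
  assert (Hcone : forall z, cone kappa z -> sector delta z).
  { intros z Hz. destruct (Hcs z Hz) as [r [phi [H1 [H2 H3]]]].
    exists r, phi. repeat split; try assumption. lra. }
  destruct (local_uniform_boundedness X {z : C | cone kappa z}
    (fun z => Cmod (proj1_sig z)) (fun z => U (proj1_sig z))) as [M [eta [HM [He H]]]].
  { exact HX. }
  { intros [z Hz]; simpl. apply HU1, Hcone, Hz. }
  { intros x. assert (F := HU4 (delta / 2) x ltac:(lra)).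
    rewrite (filterlim_norm_iff C X (within (sector (delta / 2)) (locally (RtoC 0)))) in F.
    destruct (F 1 Rlt_0_1) as [d Hd].
    exists (norm x + 1), d. split; [apply cond_pos|].
    intros [z Hz]; simpl. intros Hzd.
    assert (N := norm_le_minus X (U z x) x).
    assert (norm (minus (U z x) x) < 1); [|lra].
    apply Hd; [|apply Hcs, Hz].
    apply C_NormedModule_mixin_compat1.
    replace (minus z (RtoC 0)) with z; [exact Hzd|].
    change (z = Cminus z (RtoC 0)). ring. }
  assert (Hder : forall t, 0 < t -> exists L, is_linear L /\
     forall x, is_cderiv (fun z => U z x) (RtoC t) (L x)).
  { intros t Ht.
    assert (Hct : cone kappa (RtoC t)) by (apply cone_real; lra).
    destruct (HU3 _ (Hcone _ Hct)) as [L [HL HLd]].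
    exists L. split; [exact HL|]. intros x eps Heps.
    assert (Hx := norm_ge_0 x).
    assert (Heps' : 0 < eps / (norm x + 1)) by (apply Rdiv_lt_0_compat; lra).
    destruct (HLd _ Heps') as [d Hd].
    assert (Hkt : 0 < kappa * t) by (apply Rmult_lt_0_compat; lra).
    exists (Rmin d (kappa * t / 2)). split; [apply Rmin_glb_lt; [apply cond_pos|lra]|].
    intros h Hh.
    assert (Hlin0 := HU1 _ (Hcone _ Hct)).
    assert (Hlinh := HU1 _ (Hcone _ (cone_near_real kappa t h Hk
                       (Rlt_le_trans _ _ _ Hh (Rmin_r _ _))))).
    destruct (classic (h = RtoC 0)) as [->|Hh0].
    { rewrite Cplus_0_r, Cmod_0, Rmult_0_r.
      rewrite (scal_zero_l (L x) : scal (RtoC 0) (L x) = zero).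
      rewrite norm_minus_zero, norm_minus_diag. lra. }
    assert (Q : Rbar_le (opnorm (fun x => minus (scal (Cinv h)
                   (minus (U (Cplus (RtoC t) h) x) (U (RtoC t) x))) (L x))) (eps / (norm x + 1))).
    { apply Rbar_lt_le, Hd; [|exact Hh0].
      apply C_NormedModule_mixin_compat1.
      replace (minus h (RtoC 0)) with h;
        [exact (Rlt_le_trans _ _ _ Hh (Rmin_l _ _))|].
      change (h = Cminus h (RtoC 0)). ring. }
    apply (opnorm_le X _ _ x) in Q.
    - replace (minus (minus (U (Cplus (RtoC t) h) x) (U (RtoC t) x)) (scal h (L x)))
        with (scal h (minus (scal (Cinv h)
                   (minus (U (Cplus (RtoC t) h) x) (U (RtoC t) x))) (L x)))
        by (vlin; field; exact Hh0).
      rewrite norm_scalC. eapply Rle_trans; [apply Rmult_le_compat_l; [apply Cmod_ge_0|exact Q]|].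
      rewrite (Rmult_comm eps). apply Rmult_le_compat_l; [apply Cmod_ge_0|].
      apply Rle_trans with (eps / (norm x + 1) * (norm x + 1)).
      + apply Rmult_le_compat_l; lra.
      + right; field; lra.
    - intros k z. rewrite (linear_scal _ Hlin0), (linear_scal _ Hlinh), (linear_scal _ HL).
      vring. }
  assert (Hreal : forall t x y, 0 < t -> is_cderiv (fun z => U z x) (RtoC t) y ->
            dom A (T t x) /\ app A (T t x) = y).
  { intros t x y Ht Hy. apply (generates_right_derivative X A T _ _ HA).
    intros eps Heps. destruct (Hy eps Heps) as [d [Hd H']].
    exists d. split; [exact Hd|]. intros h Hh. specialize (H' (RtoC h)).
    rewrite Cmod_R, Rabs_pos_eq, <- RtoC_plus, !HU0 in H' by lra.
    rewrite <- (proj1 (proj2 (proj2 HT))), Rplus_comm by lra. apply H'; lra. }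
  split.
  - intros t x Ht. destruct (Hder t Ht) as [L [_ HL]].
    exact (proj1 (Hreal t x (L x) Ht (HL x))).
  - exists (8 * M / kappa), (eta / 2). split; [|split; [lra|]].
    { apply Rdiv_lt_0_compat; lra. }
    intros t x Ht.
    destruct (holomorphic_semigroup_derivative_bound X U kappa M eta) with (t := t) (x := x)
      as [y [Hy1 Hy2]]; try assumption.
    + intros z Hz. apply HU1, Hcone, Hz.
    + intros z w z' Hz Hw. apply HU2; apply Hcone; assumption.
    + intros z z' Hz Hz'. exact (H (exist _ z Hz) z' Hz').
    + rewrite (proj2 (Hreal t x y (proj1 Ht) Hy1)). exact Hy2.
Qed.

(** * Strong stability is uniform after a compact operator *)

(** Bounded operators that tend to zero strongly do so uniformly on relatively
    compact sets, here on the image of the unit ball under [K]. *)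
Lemma strong_stability_compact (X : NormedModule C_AbsRing) (S : R -> X -> X)
    (K : X -> X) (M t1 : R) :
  C0_semigroup S -> strongly_stable S -> 0 < M -> 0 < t1 ->
  (forall t x, t1 <= t -> norm (S t x) <= M * norm x) ->
  compact_operator K ->
  forall eta, 0 < eta -> exists t0, t1 <= t0 /\
    forall t x, t0 <= t -> norm (S t (K x)) <= eta * norm x.
Proof.
  intros HS Hst HM0 Ht1 HM [HK Hcomp] eta Heta. apply NNPP. intros Hneg.
  assert (Hbad : forall n : nat, exists p : R * X, t1 <= fst p /\ INR n <= fst p /\
             norm (snd p) <= 1 /\ eta < norm (S (fst p) (K (snd p)))).
  { intros n. apply NNPP. intros Hn. apply Hneg. exists (t1 + INR n).
    assert (Hp := pos_INR n). split; [lra|].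
    intros t x Ht. apply Rnot_lt_le. intros Hlt. apply Hn.
    assert (HSt : is_linear (S t)) by (apply HS; lra).
    assert (Hx : 0 < norm x).
    { destruct (norm_ge_0 x) as [|E]; [assumption|exfalso].
      symmetry in E; apply norm_eq_zero in E. subst x.
      rewrite (linear_zero K HK), (linear_zero _ HSt), norm_zero in Hlt. lra. }
    assert (Hi : 0 < / norm x) by (apply Rinv_0_lt_compat, Hx).
    exists (t, scal (RtoC (/ norm x)) x). cbn [fst snd].
    rewrite (linear_scal K HK), (linear_scal _ HSt), !norm_scalR by lra.
    split; [lra|]. split; [lra|]. split; [right; field; lra|].
    apply Rmult_lt_reg_r with (norm x); [exact Hx|].
    replace (/ norm x * norm (S t (K x)) * norm x) with (norm (S t (K x)))
      by (field; lra). exact Hlt. }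
  set (p := fun n => proj1_sig (constructive_indefinite_description _ (Hbad n))).
  assert (Hp : forall n : nat, t1 <= fst (p n) /\ INR n <= fst (p n) /\
             norm (snd (p n)) <= 1 /\ eta < norm (S (fst (p n)) (K (snd (p n)))))
    by (intros n; exact (proj2_sig (constructive_indefinite_description _ (Hbad n)))).
  destruct (Hcomp (fun n => snd (p n)) 1 (fun n => proj1 (proj2 (proj2 (Hp n)))))
    as [k [y [Hk Hy]]].
  assert (Hkn : forall n, (n <= k n)%nat).
  { induction n as [|n IH]; [lia|]. specialize (Hk n). lia. }
  rewrite (filterlim_norm_iff nat X eventually) in Hy.
  destruct (Hy (eta / (2 * M))) as [n1 Hn1]; [apply Rdiv_lt_0_compat; lra|].
  specialize (Hst y). apply is_lim_spec in Hst.
  destruct (Hst (mkposreal (eta / 2) ltac:(lra))) as [a Ha]. simpl in Ha.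
  destruct (INR_archimed 1 (Rabs a)) as [n2 Hn2]; [lra|].
  set (n := Nat.max n1 n2).
  destruct (Hp (k n)) as [P1 [P2 [_ P4]]].
  set (t := fst (p (k n))) in *. set (x := snd (p (k n)) : X) in *.
  assert (HSt : is_linear (S t)) by (apply HS; lra).
  assert (Hx : norm (minus (K x) y) < eta / (2 * M)) by (apply Hn1; unfold n; lia).
  assert (Hty : norm (S t y) < eta / 2).
  { specialize (Ha t). rewrite Rminus_0_r, Rabs_pos_eq in Ha by apply norm_ge_0.
    apply Ha. assert (Q := Rle_abs a).
    assert (INR n2 <= INR (k n)) by (apply le_INR; specialize (Hkn n); unfold n in *; lia).
    lra. }
  assert (T1 := norm_le_minus X (S t (K x)) (S t y)).
  rewrite <- (linear_minus _ _ _ HSt) in T1.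
  assert (T2 := HM t (minus (K x) y) P1).
  assert (T3 : M * norm (minus (K x) y) <= eta / 2).
  { apply Rle_trans with (M * (eta / (2 * M))).
    - apply Rmult_le_compat_l; lra.
    - right; field; lra. }
  lra.
Qed.

(** * The orbit [s |-> S (t - s) (T s x)] *)

(** On the common domain the generators of [S] and [T] differ by [B]. *)
Lemma generators_difference (X : NormedModule C_AbsRing) (A B : operator X)
    (T S : R -> X -> X) (y : X) :
  generates A T -> generates (add_operator A B) S -> dom A y ->
  forall eps, 0 < eps -> exists d, 0 < d /\ forall h, 0 < h < d ->
    norm (plus (minus (T h y) (S h y)) (scal (RtoC h) (app B y))) <= eps * h.
Proof.
  intros HA HAB Hy eps He.
  destruct (proj1 (generates_right_derivative X A T y _ HA) (conj Hy eq_refl) (eps / 2))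
    as [d1 [Hd1 H1]]; [lra|].
  destruct (proj1 (generates_right_derivative X (add_operator A B) S y
              (plus (app A y) (app B y)) HAB) (conj Hy eq_refl) (eps / 2))
    as [d2 [Hd2 H2]]; [lra|].
  exists (Rmin d1 d2). split; [apply Rmin_glb_lt; assumption|].
  intros h Hh.
  specialize (H1 h (conj (proj1 Hh) (Rlt_le_trans _ _ _ (proj2 Hh) (Rmin_l _ _)))).
  specialize (H2 h (conj (proj1 Hh) (Rlt_le_trans _ _ _ (proj2 Hh) (Rmin_r _ _)))).
  replace (plus (minus (T h y) (S h y)) (scal (RtoC h) (app B y))) with
    (minus (minus (minus (T h y) y) (scal (RtoC h) (app A y)))
           (minus (minus (S h y) y) (scal (RtoC h) (plus (app A y) (app B y)))))
    by vring.
  eapply Rle_trans; [apply norm_minus_le|]. lra.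
Qed.

Lemma orbit_difference (X : NormedModule C_AbsRing) (T S : R -> X -> X) (t s h : R) (x : X) :
  C0_semigroup T -> C0_semigroup S -> 0 <= s -> 0 <= h -> s + h <= t ->
  minus (S (t - (s + h)) (T (s + h) x)) (S (t - s) (T s x)) =
  S (t - (s + h)) (minus (T h (T s x)) (S h (T s x))).
Proof.
  intros [_ [_ [HT _]]] [HSl [_ [HS _]]] Hs Hh Ht.
  rewrite (linear_minus (S (t - (s + h)))) by (apply HSl; lra).
  rewrite <- HS, <- HT by lra.
  replace (h + s) with (s + h) by ring.
  replace (t - (s + h) + h) with (t - s) by ring. reflexivity.
Qed.

Lemma orbit_continuous (X : NormedModule C_AbsRing) (T S : R -> X -> X)
    (t N t1 M MT : R) (x : X) :
  sequentially_complete X -> C0_semigroup T -> C0_semigroup S ->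
  0 < t1 -> 0 < M -> 0 < MT -> t1 <= t - N ->
  (forall s z, t1 <= s -> norm (S s z) <= M * norm z) ->
  (forall s z, 0 <= s -> norm (T s z) <= MT * norm z) ->
  norm_continuous_on (fun s => S (t - s) (T s x)) 0 N.
Proof.
  intros HX HT HS Ht1 HM0 HMT0 HtN HM HMT s eps Hs He.
  destruct (C0_locally_bounded X S HX HS 1) as [MS [HMS1 HMS]].
  set (y := T s x).
  (* The summand [(MT + MS) * MT] accounts for increments that end at [s]: there
     [T s' x] has first to be replaced by [T s x]. *)
  set (c := M * (1 + (MT + MS) * MT)).
  assert (Hc : 0 < c).
  { unfold c. apply Rmult_lt_0_compat; [lra|].
    assert (0 < (MT + MS) * MT) by (apply Rmult_lt_0_compat; lra). lra. }
  set (e := eps / (2 * c)).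
  assert (He' : 0 < e) by (apply Rdiv_lt_0_compat; lra).
  destruct (C0_right_continuous X T y HT e He') as [d1 [Hd1 H1]].
  destruct (C0_right_continuous X S y HS e He') as [d2 [Hd2 H2]].
  destruct (C0_right_continuous X T x HT e He') as [d3 [Hd3 H3]].
  assert (Hce : c * (2 * e) = eps) by (unfold e; field; lra).
  set (d := Rmin (Rmin d1 d2) (Rmin d3 1)).
  exists d. split; [unfold d; repeat apply Rmin_glb_lt; lra|].
  assert (Hd : forall h, 0 <= h < d -> h < d1 /\ h < d2 /\ h < d3 /\ h < 1).
  { intros h Hh. unfold d in Hh.
    assert (Q1 := Rmin_l (Rmin d1 d2) (Rmin d3 1)). assert (Q2 := Rmin_r (Rmin d1 d2) (Rmin d3 1)).
    assert (Q3 := Rmin_l d1 d2). assert (Q4 := Rmin_r d1 d2).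
    assert (Q5 := Rmin_l d3 1). assert (Q6 := Rmin_r d3 1). lra. }
  assert (Hdiff : forall h, 0 <= h < d -> norm (minus (T h y) (S h y)) <= 2 * e).
  { intros h Hh. destruct (Hd h Hh) as [K1 [K2 _]].
    specialize (H1 h (conj (proj1 Hh) K1)). specialize (H2 h (conj (proj1 Hh) K2)).
    assert (Q := norm_minus_triangle X y (T h y) (S h y)).
    rewrite (norm_minus_sym X y) in Q. lra. }
  intros s' Hs' Hlt. apply Rabs_def2 in Hlt. cbv beta.
  destruct (Rle_or_lt s s') as [Hle|Hgt].
  - set (h := s' - s). assert (Hh : 0 <= h < d) by (unfold h; lra).
    replace s' with (s + h) by (unfold h; ring).
    rewrite orbit_difference by (try assumption; unfold h; lra).
    eapply Rle_trans; [apply HM; unfold h; lra|].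
    rewrite <- Hce. apply Rle_trans with (M * (2 * e)).
    + apply Rmult_le_compat_l; [lra|apply Hdiff, Hh].
    + apply Rmult_le_compat_r; [lra|]. unfold c.
      rewrite <- (Rmult_1_r M) at 1. apply Rmult_le_compat_l; [lra|].
      assert (0 < (MT + MS) * MT) by (apply Rmult_lt_0_compat; lra). lra.
  - set (h := s - s'). assert (Hh : 0 <= h < d) by (unfold h; lra).
    destruct (Hd h Hh) as [_ [_ [K3 K4]]].
    rewrite norm_minus_sym. unfold y.
    replace (S (t - s) (T s x)) with (S (t - (s' + h)) (T (s' + h) x))
      by (replace (s' + h) with s by (unfold h; ring); reflexivity).
    rewrite orbit_difference by (try assumption; unfold h; lra).
    set (y' := T s' x).
    assert (HTh : is_linear (T h)) by (apply HT; lra).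
    assert (HSh : is_linear (S h)) by (apply HS; lra).
    assert (Hy : norm (minus y' y) <= MT * e).
    { unfold y, y'. replace s with (s' + h) by (unfold h; ring).
      rewrite (proj1 (proj2 (proj2 HT))) by lra.
      rewrite <- (linear_minus (T s')) by (apply HT; lra).
      eapply Rle_trans; [apply HMT; lra|]. apply Rmult_le_compat_l; [lra|].
      rewrite norm_minus_sym. left. apply H3. lra. }
    assert (Hfin : norm (minus (T h y') (S h y')) <= 2 * e + (MT + MS) * (MT * e)).
    { replace (minus (T h y') (S h y')) with
        (plus (minus (T h y) (S h y))
              (minus (T h (minus y' y)) (S h (minus y' y))))
        by (rewrite (linear_minus _ _ _ HTh), (linear_minus _ _ _ HSh); vring).
      eapply Rle_trans; [apply norm_triangle|].
      apply Rplus_le_compat; [apply Hdiff, Hh|].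
      eapply Rle_trans; [apply norm_minus_le|].
      assert (Q1 := HMT h (minus y' y) (proj1 Hh)).
      assert (Q2 := HMS h (minus y' y) ltac:(lra)).
      apply Rle_trans with ((MT + MS) * norm (minus y' y)); [lra|].
      apply Rmult_le_compat_l; lra. }
    eapply Rle_trans; [apply HM; unfold h; lra|].
    rewrite <- Hce. unfold c. rewrite Rmult_assoc. apply Rmult_le_compat_l; [lra|].
    eapply Rle_trans; [exact Hfin|].
    assert (0 < (MT + MS) * MT * e)
      by (apply Rmult_lt_0_compat; [apply Rmult_lt_0_compat; lra|lra]).
    lra.
Qed.

(** Formally the orbit has derivative [- S (t - s) B T(s) x]. No product rule is
    needed, because an increment is [S (t - s - h)] applied to the difference of two
    increments at 0, those of [T] and of [S] at the vector [T s x] of the domain. *)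
Lemma orbit_increment (X : NormedModule C_AbsRing) (A B : operator X)
    (T S : R -> X -> X) (t a b t1 M : R) (g G : R -> R) (x : X) :
  generates A T -> generates (add_operator A B) S ->
  0 <= a <= b -> 0 < t1 -> 0 < M -> t1 <= t - b ->
  (forall s z, t1 <= s -> norm (S s z) <= M * norm z) ->
  norm_continuous_on (fun s => S (t - s) (T s x)) a b ->
  (forall s, a <= s < b -> dom A (T s x)) ->
  (forall s r, a <= s < b -> t - b <= r -> norm (S r (app B (T s x))) <= g s) ->
  norm_continuous_on G a b ->
  (forall s eps, a <= s < b -> 0 < eps -> exists d, 0 < d /\
     forall h, 0 < h < d -> s + h <= b -> h * g s <= G (s + h) - G s + eps * h) ->
  norm (minus (S (t - b) (T b x)) (S (t - a) (T a x))) <= G b - G a.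
Proof.
  intros HA HAB Hab Ht1 HM0 Htb HM Hf Hdom Hg HG HGd.
  assert (HT := proj1 HA). assert (HS := proj1 HAB).
  apply (mean_value_ineq X (fun s => S (t - s) (T s x)) G); [lra|exact Hf|exact HG|].
  intros s eps Hs He.
  destruct (HGd s (eps / 2) Hs ltac:(lra)) as [d1 [Hd1 H1]].
  destruct (generators_difference X A B T S (T s x) HA HAB (Hdom s Hs) (eps / (2 * M)))
    as [d2 [Hd2 H2]]; [apply Rdiv_lt_0_compat; lra|].
  exists (Rmin d1 d2). split; [apply Rmin_glb_lt; assumption|].
  intros h Hh Hsh.
  specialize (H1 h (conj (proj1 Hh) (Rlt_le_trans _ _ _ (proj2 Hh) (Rmin_l _ _))) Hsh).
  specialize (H2 h (conj (proj1 Hh) (Rlt_le_trans _ _ _ (proj2 Hh) (Rmin_r _ _)))).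
  cbv beta. rewrite orbit_difference by (try assumption; lra).
  set (y := T s x) in *.
  assert (HSl : is_linear (S (t - (s + h)))) by (apply HS; lra).
  replace (minus (T h y) (S h y)) with
    (minus (plus (minus (T h y) (S h y)) (scal (RtoC h) (app B y)))
           (scal (RtoC h) (app B y))) by vring.
  rewrite (linear_minus _ _ _ HSl), (linear_scal _ HSl (RtoC h)).
  eapply Rle_trans; [apply norm_minus_le|]. rewrite norm_scalR by lra.
  assert (Q1 := HM (t - (s + h)) (plus (minus (T h y) (S h y)) (scal (RtoC h) (app B y)))
                  ltac:(lra)).
  assert (Q2 : h * norm (S (t - (s + h)) (app B y)) <= h * g s)
    by (apply Rmult_le_compat_l; [lra|apply Hg; lra]).
  assert (Q3 : M * norm (plus (minus (T h y) (S h y)) (scal (RtoC h) (app B y)))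
               <= eps / 2 * h).
  { apply Rle_trans with (M * (eps / (2 * M) * h)).
    - apply Rmult_le_compat_l; [lra|exact H2].
    - right; field; lra. }
  lra.
Qed.

(** * The subordinate perturbation *)

Lemma nnpow_le (x y p : R) : 0 <= x <= y -> 0 <= p -> nnpow x p <= nnpow y p.
Proof.
  intros Hx Hp. unfold nnpow. destruct (Req_EM_T p 0); [lra|].
  destruct (Req_EM_T x 0), (Req_EM_T y 0); try lra.
  - left. apply exp_pos.
  - apply Rle_Rpower_l; lra.
Qed.

Lemma nnpow_pos (x p : R) : 0 < x -> nnpow x p = Rpower x p.
Proof.
  intros Hx. unfold nnpow. destruct (Req_EM_T p 0) as [->|].
  - symmetry; apply Rpower_O, Hx.
  - destruct (Req_EM_T x 0); [lra|reflexivity].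
Qed.

Lemma subordinate_smoothing (X : NormedModule C_AbsRing) (A B : operator X)
    (T : R -> X -> X) (theta K s0 MT : R) :
  0 <= theta < 1 -> subordinate theta B A -> 0 < K -> 0 < MT ->
  (forall t x, 0 < t -> dom A (T t x)) ->
  (forall t x, 0 < t < s0 -> norm (app A (T t x)) <= K / t * norm x) ->
  (forall t x, 0 <= t -> norm (T t x) <= MT * norm x) ->
  exists c, 0 < c /\ forall t x, 0 < t < s0 ->
    norm (app B (T t x)) <= c * Rpower t (- theta) * norm x.
Proof.
  intros Hth [_ [c [Hc Hsub]]] HK HMT Hdom HA HT.
  exists (c * Rpower K theta * Rpower MT (1 - theta)).
  split; [repeat apply Rmult_lt_0_compat; [exact Hc|apply exp_pos|apply exp_pos]|].
  intros t x Ht. eapply Rle_trans; [apply Hsub, Hdom; lra|].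
  assert (HAt := HA t x Ht). assert (HTt := HT t x ltac:(lra)).
  assert (HKt : 0 < K / t) by (apply Rdiv_lt_0_compat; lra).
  assert (P : forall z p, 0 <= nnpow z p).
  { intros z p. unfold nnpow. destruct (Req_EM_T p 0); [lra|].
    destruct (Req_EM_T z 0); [lra|left; apply exp_pos]. }
  destruct (norm_ge_0 x) as [Hx|Hx].
  - apply Rle_trans with
      (c * nnpow (K / t * norm x) theta * nnpow (MT * norm x) (1 - theta)).
    + apply Rmult_le_compat; [apply Rmult_le_pos; [lra|apply P]|apply P| |].
      * apply Rmult_le_compat_l; [lra|]. apply nnpow_le; [|lra].
        split; [apply norm_ge_0|exact HAt].
      * apply nnpow_le; [|lra]. split; [apply norm_ge_0|exact HTt].
    + rewrite !nnpow_pos by (apply Rmult_lt_0_compat; lra).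
      unfold Rdiv. rewrite <- !Rpower_mult_distr; try lra;
        try (apply Rmult_lt_0_compat; lra); try (apply Rinv_0_lt_compat; lra).
      assert (E1 : Rpower (/ t) theta = Rpower t (- theta)).
      { unfold Rpower. rewrite ln_Rinv by lra. f_equal. ring. }
      assert (E2 : norm x = Rpower (norm x) theta * Rpower (norm x) (1 - theta)).
      { rewrite <- Rpower_plus. replace (theta + (1 - theta)) with 1 by ring.
        symmetry; apply Rpower_1, Hx. }
      rewrite E1. right. rewrite E2 at 3. ring.
  - rewrite <- Hx, Rmult_0_r in HTt. rewrite <- Hx, Rmult_0_r.
    assert (E : norm (T t x) = 0) by (apply Rle_antisym; [exact HTt|apply norm_ge_0]).
    rewrite E. unfold nnpow at 2.
    destruct (Req_EM_T (1 - theta) 0); [lra|]. destruct (Req_EM_T 0 0); lra.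
Qed.

(** * Exponential stability *)

Lemma exp_monotone (x y : R) : x <= y -> exp x <= exp y.
Proof. intros [H|<-]; [left; apply exp_increasing, H|lra]. Qed.

Lemma contraction_exp_stable (X : NormedModule C_AbsRing) (S : R -> X -> X) (a : R) :
  sequentially_complete X -> C0_semigroup S -> 0 < a ->
  (forall x, norm (S a x) <= / 2 * norm x) -> uniformly_exp_stable S.
Proof.
  intros HX HS Ha Hhalf.
  destruct (C0_locally_bounded X S HX HS a) as [K [HK1 HK]].
  set (w := ln 2 / a).
  assert (Hln : 0 < ln 2) by (rewrite <- ln_1; apply ln_increasing; lra).
  assert (Hw : 0 < w) by (apply Rdiv_lt_0_compat; lra).
  assert (Hwa : exp (- w * a) = / 2).
  { replace (- w * a) with (- ln 2) by (unfold w; field; lra).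
    rewrite exp_Ropp, exp_ln; lra. }
  assert (Hn : forall n : nat, forall t x, 0 <= t <= INR n * a ->
            norm (S t x) <= 2 * K * exp (- w * t) * norm x).
  { induction n as [|n IH]; intros t x Ht; [simpl in Ht|rewrite S_INR in Ht].
    all: destruct (Rle_or_lt t a) as [Hta|Hta].
    2: lra.
    1, 2: eapply Rle_trans; [apply HK; lra|];
          apply Rmult_le_compat_r; [apply norm_ge_0|];
          assert (E : / 2 <= exp (- w * t));
          [rewrite <- Hwa; apply exp_monotone; assert (w * t <= w * a) by
             (apply Rmult_le_compat_l; lra); lra
          |apply Rmult_le_compat_l with (r := 2 * K) in E; lra].
    replace t with (a + (t - a)) at 1 by ring.
    rewrite (proj1 (proj2 (proj2 HS))) by lra.
    eapply Rle_trans; [apply Hhalf|].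
    eapply Rle_trans; [apply Rmult_le_compat_l; [lra|apply IH; lra]|].
    right. replace (- w * t) with (- w * a + - w * (t - a)) by ring.
    rewrite exp_plus, Hwa. ring. }
  exists (2 * K), w. split; [lra|]. split; [exact Hw|]. intros t Ht.
  apply le_opnorm.
  - apply Rmult_le_pos; [lra|left; apply exp_pos].
  - intros x. destruct (INR_archimed a t) as [n Hna]; [exact Ha|].
    apply (Hn n). lra.
Qed.

Lemma exp_stable_bounded (X : NormedModule C_AbsRing) (T : R -> X -> X) :
  C0_semigroup T -> uniformly_exp_stable T ->
  exists M w, 1 <= M /\ 0 < w /\
    (forall t x, 0 <= t -> norm (T t x) <= M * exp (- w * t) * norm x) /\
    (forall t x, 0 <= t -> norm (T t x) <= M * norm x).
Proof.
  intros HT [M [w [HM [Hw H]]]]. exists M, w. split; [exact HM|]. split; [exact Hw|].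
  assert (K : forall t x, 0 <= t -> norm (T t x) <= M * exp (- w * t) * norm x).
  { intros t x [Ht|<-].
    - apply opnorm_le; [|apply H, Ht]. intros k y. apply linear_scal, HT. lra.
    - rewrite (proj1 (proj2 HT)), Rmult_0_r, exp_0, Rmult_1_r.
      assert (Hn := norm_ge_0 x). nra. }
  split; [exact K|]. intros t x Ht. eapply Rle_trans; [apply K, Ht|].
  apply Rmult_le_compat_r; [apply norm_ge_0|].
  rewrite <- (Rmult_1_r M) at 2. apply Rmult_le_compat_l; [lra|].
  rewrite <- exp_0. apply exp_monotone. assert (0 <= w * t) by (apply Rmult_le_pos; lra). lra.
Qed.

(** On [0, e] the derivative of the orbit is bounded by [M c s^(- theta) |x|], whose
    primitive [M c s^(1 - theta) / (1 - theta) |x|] vanishes at zero;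
    continuity of the orbit allows the singular left end point to be included. *)
Lemma orbit_increment_near_0 (X : NormedModule C_AbsRing) (A B : operator X)
    (T S : R -> X -> X) (t e t1 M c theta : R) (x : X) :
  generates A T -> generates (add_operator A B) S ->
  0 <= theta < 1 -> 0 < e -> 0 < t1 -> 0 < M -> 0 < c -> t1 <= t - e ->
  (forall s z, t1 <= s -> norm (S s z) <= M * norm z) ->
  norm_continuous_on (fun s => S (t - s) (T s x)) 0 e ->
  (forall s, 0 < s -> dom A (T s x)) ->
  (forall s, 0 < s < e -> norm (app B (T s x)) <= c * Rpower s (- theta) * norm x) ->
  norm (minus (S (t - e) (T e x)) (S (t - 0) (T 0 x)))
    <= M * c / (1 - theta) * Rpower e (1 - theta) * norm x.
Proof.
  intros HA HAB Hth He Ht1 HM0 Hc Hte HM Hf Hdom HB.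
  set (C1 := M * c / (1 - theta) * norm x).
  assert (HC1 : 0 <= C1).
  { apply Rmult_le_pos; [|apply norm_ge_0].
    apply Rdiv_le_0_compat; [apply Rmult_le_pos|]; lra. }
  set (G := fun s => C1 * Rpower s (1 - theta)).
  assert (HG : forall s, 0 < s -> is_derive G s (M * c * Rpower s (- theta) * norm x)).
  { intros s Hs. unfold G, Rpower. auto_derive; [exact Hs|].
    replace ((1 - theta) * ln s) with (- theta * ln s + ln s) by ring.
    rewrite exp_plus, exp_ln by exact Hs. unfold C1. field. split; lra. }
  assert (Hd : forall s eps, 0 < s -> 0 < eps -> exists d, 0 < d /\ forall s',
     Rabs (s' - s) < d ->
     Rabs (G s' - G s - (s' - s) * (M * c * Rpower s (- theta) * norm x))
       <= eps * Rabs (s' - s)).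
  { intros s eps Hs Heps. destruct (HG s Hs) as [_ H].
    destruct (H s (fun P HP => HP) (mkposreal eps Heps)) as [d Hd].
    exists d. split; [apply cond_pos|]. intros s' Hs'. exact (Hd s' Hs'). }
  assert (Hmain : forall a, 0 < a <= e ->
     norm (minus (S (t - e) (T e x)) (S (t - a) (T a x))) <= G e - G a).
  { intros a Ha.
    apply orbit_increment with (A := A) (B := B) (t1 := t1) (M := M)
      (g := fun s => M * c * Rpower s (- theta) * norm x); try assumption; try lra.
    - intros s eps Hs Heps. destruct (Hf s eps ltac:(lra) Heps) as [d [Hd0 H]].
      exists d. split; [exact Hd0|]. intros s' Hs' Hlt. apply H; lra.
    - intros s Hs. apply Hdom; lra.
    - intros s r Hs Hr. eapply Rle_trans; [apply HM; lra|].
      rewrite !Rmult_assoc. apply Rmult_le_compat_l; [lra|].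
      rewrite <- Rmult_assoc. apply HB; lra.
    - intros s eps Hs Heps. destruct (Hd s 1 ltac:(lra) Rlt_0_1) as [d [Hd0 H]].
      set (g := M * c * Rpower s (- theta) * norm x) in *.
      assert (Hg : 0 <= Rabs g) by apply Rabs_pos.
      exists (Rmin d (eps / (Rabs g + 1))).
      split; [apply Rmin_glb_lt; [lra|apply Rdiv_lt_0_compat; lra]|].
      intros s' _ Hlt. change (Rabs (G s' - G s) <= eps).
      specialize (H s' (Rlt_le_trans _ _ _ Hlt (Rmin_l _ _))).
      replace (G s' - G s) with ((G s' - G s - (s' - s) * g) + (s' - s) * g) by ring.
      eapply Rle_trans; [apply Rabs_triang|]. rewrite (Rabs_mult (s' - s) g).
      apply Rle_trans with ((Rabs g + 1) * (eps / (Rabs g + 1))); [|right; field; lra].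
      assert (Q : Rabs (s' - s) <= eps / (Rabs g + 1))
        by (left; exact (Rlt_le_trans _ _ _ Hlt (Rmin_r _ _))).
      apply Rmult_le_compat_l with (r := Rabs g + 1) in Q; lra.
    - intros s eps Hs Heps. destruct (Hd s eps ltac:(lra) Heps) as [d [Hd0 H]].
      exists d. split; [exact Hd0|]. intros h Hh _. specialize (H (s + h)).
      replace (s + h - s) with h in H by ring. rewrite (Rabs_pos_eq h) in H by lra.
      specialize (H (proj2 Hh)). apply Rabs_le_between in H. lra. }
  apply le_epsilon. intros eps Heps.
  destruct (Hf 0 eps ltac:(lra) Heps) as [d [Hd0 H]].
  set (a := Rmin (d / 2) e).
  assert (Ha : 0 < a <= e /\ a < d).
  { unfold a, Rmin; destruct (Rle_dec (d / 2) e); lra. }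
  specialize (H a ltac:(lra)). rewrite Rminus_0_r, Rabs_pos_eq in H by lra.
  specialize (H (proj2 Ha)). cbv beta in H.
  eapply Rle_trans; [apply (norm_minus_triangle X (S (t - a) (T a x)))|].
  specialize (Hmain a (proj1 Ha)).
  assert (0 <= G a) by (apply Rmult_le_pos; [exact HC1|left; apply exp_pos]).
  replace (M * c / (1 - theta) * Rpower e (1 - theta) * norm x) with (G e)
    by (unfold G, C1; ring).
  apply Rplus_le_compat; [lra|exact H].
Qed.

(** Away from zero, [B T(s) = B T(e) T(s - e)] and the compact operator [B T(e)]
    makes the derivative of the orbit uniformly small. *)
Lemma orbit_increment_away_from_0 (X : NormedModule C_AbsRing) (A B : operator X)
    (T S : R -> X -> X) (t e N t1 M MT eta : R) (x : X) :
  generates A T -> generates (add_operator A B) S ->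
  0 < e <= N -> 0 < t1 -> 0 < M -> 0 < MT -> 0 < eta -> t1 <= t - N ->
  (forall s z, t1 <= s -> norm (S s z) <= M * norm z) ->
  (forall s z, 0 <= s -> norm (T s z) <= MT * norm z) ->
  norm_continuous_on (fun s => S (t - s) (T s x)) 0 N ->
  (forall s, 0 < s -> dom A (T s x)) ->
  (forall s z, t - N <= s -> norm (S s (app B (T e z))) <= eta * norm z) ->
  norm (minus (S (t - N) (T N x)) (S (t - e) (T e x))) <= eta * MT * N * norm x.
Proof.
  intros HA HAB He Ht1 HM0 HMT0 Heta HtN HM HMT Hf Hdom HB.
  set (g := eta * MT * norm x).
  assert (Hg : 0 <= g).
  { apply Rmult_le_pos; [apply Rmult_le_pos; lra|apply norm_ge_0]. }
  apply Rle_trans with (g * N - g * e).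
  2:{ assert (0 <= g * e) by (apply Rmult_le_pos; lra). unfold g in *. lra. }
  apply (orbit_increment X A B T S t e N t1 M (fun _ => g) (fun s => g * s));
    try assumption; try lra.
  - intros s eps Hs Heps. destruct (Hf s eps ltac:(lra) Heps) as [d [Hd0 H]].
    exists d. split; [exact Hd0|]. intros s' Hs' Hlt. apply H; lra.
  - intros s Hs. apply Hdom; lra.
  - intros s r Hs Hr. replace s with (e + (s - e)) by ring.
    rewrite (proj1 (proj2 (proj2 (proj1 HA)))) by lra.
    eapply Rle_trans; [apply HB; lra|]. unfold g. rewrite Rmult_assoc.
    apply Rmult_le_compat_l; [lra|]. apply HMT; lra.
  - intros s eps Hs Heps. exists (eps / (g + 1)). split; [apply Rdiv_lt_0_compat; lra|].
    intros s' _ Hlt. change (Rabs (g * s' - g * s) <= eps).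
    rewrite <- Rmult_minus_distr_l, Rabs_mult, (Rabs_pos_eq g) by exact Hg.
    apply Rle_trans with ((g + 1) * (eps / (g + 1))); [|right; field; lra].
    apply Rmult_le_compat; [exact Hg|apply Rabs_pos|lra|lra].
  - intros s eps Hs Heps. exists 1. split; [lra|]. intros h Hh _.
    assert (0 <= eps * h) by (apply Rmult_le_pos; lra). lra.
Qed.

Theorem theorem2 (X : CompleteNormedModule C_AbsRing) (A B : operator X)
  (T S : R -> X -> X) (theta : R)
  (hA : generates A T) (hT : analytic_semigroup T)
  (hB : linear_operator B)
  (hAB : generates (add_operator A B) S)
  (htheta : 0 <= theta < 1)
  (hsub : subordinate theta B A)
  (hcomp : forall t, 0 < t -> compact_operator (fun x => app B (T t x)))
  (hTstab : uniformly_exp_stable T)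
  (hSstab : strongly_stable S) :
  uniformly_exp_stable S.
Proof.
  assert (HX := complete_sequentially_complete X).
  assert (HT := proj1 hA). assert (HS := proj1 hAB).
  destruct (exp_stable_bounded X T HT hTstab) as [MT [w [HMT1 [Hw [HTw HTb]]]]].
  destruct (strongly_stable_bounded X S HX HS hSstab) as [M [t0 [HM0 HM]]].
  destruct (analytic_semigroup_smoothing X A T HX hA hT)
    as [Hdom [K [s0 [HK [Hs0 HA]]]]].
  destruct (subordinate_smoothing X A B T theta K s0 MT htheta hsub HK
              ltac:(lra) Hdom HA HTb) as [c [Hc HB]].
  set (t1 := Rmax t0 1).
  assert (Ht1 : 0 < t1) by (assert (P := Rmax_r t0 1); unfold t1; lra).
  assert (HM1 : forall t x, t1 <= t -> norm (S t x) <= M * norm x).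
  { intros t x Ht. assert (P := Rmax_l t0 1). apply HM; unfold t1 in *; lra. }
  (* Each of the three contributions to [S t x] is made at most [norm x / 6]. *)
  set (C1 := M * c / (1 - theta)).
  assert (HC1 : 0 < C1)
    by (apply Rdiv_lt_0_compat; [apply Rmult_lt_0_compat|]; lra).
  assert (He : exists e, 0 < e < s0 /\ C1 * Rpower e (1 - theta) <= / 6).
  { set (q := Rpower (/ (6 * C1)) (/ (1 - theta))).
    assert (Hq : 0 < q) by apply exp_pos.
    exists (Rmin q (s0 / 2)).
    assert (H0 : 0 < Rmin q (s0 / 2)) by (apply Rmin_glb_lt; lra).
    split; [split; [exact H0|apply Rle_lt_trans with (s0 / 2); [apply Rmin_r|lra]]|].
    apply Rle_trans with (C1 * Rpower q (1 - theta)).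
    - apply Rmult_le_compat_l; [lra|]. apply Rle_Rpower_l; [lra|].
      split; [exact H0|apply Rmin_l].
    - unfold q. rewrite Rpower_mult, Rinv_l, Rpower_1 by
        (try apply Rinv_0_lt_compat; lra). right; field; lra. }
  destruct He as [e [He1 He2]].
  assert (HN : exists N, e <= N /\ M * (MT * exp (- w * N)) <= / 6).
  { set (q := 6 * M * MT / w).
    assert (Hq : 0 < q) by (apply Rdiv_lt_0_compat; [apply Rmult_lt_0_compat|]; lra).
    exists (e + q). split; [lra|].
    assert (E : exp (- w * (e + q)) <= / (6 * M * MT)).
    { replace (- w * (e + q)) with (- (w * (e + q))) by ring. rewrite exp_Ropp.
      apply Rinv_le_contravar; [apply Rmult_lt_0_compat; lra|].
      assert (P := exp_ineq1_le (w * (e + q))).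
      assert (P2 : w * q = 6 * M * MT) by (unfold q; field; lra).
      assert (0 <= w * e) by (apply Rmult_le_pos; lra). lra. }
    rewrite <- Rmult_assoc.
    apply Rle_trans with (M * MT * / (6 * M * MT)); [|right; field; lra].
    apply Rmult_le_compat_l; [apply Rmult_le_pos; lra|exact E]. }
  destruct HN as [N [HN1 HN2]].
  set (eta := / (6 * MT * N)).
  assert (Heta : 0 < eta)
    by (apply Rinv_0_lt_compat; apply Rmult_lt_0_compat; lra).
  destruct (strong_stability_compact X S (fun x => app B (T e x)) M t1 HS hSstab HM0 Ht1
              HM1 (hcomp e (proj1 He1)) eta Heta) as [r [Hr1 Hr2]].
  set (t := N + r).
  apply (contraction_exp_stable X S t HX HS); [unfold t; lra|]. intros x.
  assert (Hcont : norm_continuous_on (fun s => S (t - s) (T s x)) 0 N)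
    by (apply (orbit_continuous X T S t N t1 M MT x); try assumption; unfold t; lra).
  assert (I1 := orbit_increment_near_0 X A B T S t e t1 M c theta x hA hAB htheta
    (proj1 He1) Ht1 HM0 Hc ltac:(unfold t; lra) HM1).
  assert (I2 := orbit_increment_away_from_0 X A B T S t e N t1 M MT eta x hA hAB
    (conj (proj1 He1) HN1) Ht1 HM0 ltac:(lra) Heta ltac:(unfold t; lra) HM1 HTb Hcont
    (fun s Hs => Hdom s x Hs)).
  specialize (I2 ltac:(intros s z Hs; apply Hr2; unfold t in Hs; lra)).
  specialize (I1 ltac:(intros s eps Hs Heps;
    destruct (Hcont s eps ltac:(lra) Heps) as [d [Hd0 H]];
    exists d; split; [exact Hd0|]; intros s' Hs' Hlt; apply H; lra)).
  specialize (I1 (fun s Hs => Hdom s x Hs) (fun s Hs => HB s x ltac:(lra))).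
  rewrite Rminus_0_r, (proj1 (proj2 HT)) in I1.
  assert (I3 : norm (S (t - N) (T N x)) <= / 6 * norm x).
  { eapply Rle_trans; [apply HM1; unfold t; lra|].
    apply Rle_trans with (M * (MT * exp (- w * N) * norm x)).
    - apply Rmult_le_compat_l; [lra|]. apply HTw; lra.
    - rewrite <- Rmult_assoc. apply Rmult_le_compat_r; [apply norm_ge_0|exact HN2]. }
  assert (J1 : M * c / (1 - theta) * Rpower e (1 - theta) * norm x <= / 6 * norm x)
    by (apply Rmult_le_compat_r; [apply norm_ge_0|exact He2]).
  assert (J2 : eta * MT * N * norm x = / 6 * norm x) by (unfold eta; field; lra).
  assert (Q1 := norm_le_minus X (S t x) (S (t - e) (T e x))).
  assert (Q2 := norm_le_minus X (S (t - e) (T e x)) (S (t - N) (T N x))).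
  rewrite (norm_minus_sym X) in Q1. rewrite (norm_minus_sym X) in Q2.
  lra.
Qed.
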